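(* Let $n\ge 1$, let $L$ be an oriented link with $n$ components numbered $L_1,\dots,L_n$, and let $S=(s_{ij})$ and $T=(t_{ij})$ be symmetric $n\times n$ matrices with all entries in $\{-1,0,+1\}$ such that $t_{ij}=0$ if and only if $s_{ij}=0$. Let $D_1$ and $D_2$ be diagrams of $L$ in the $2$-sphere. Then any sequence of Reidemeister moves deforming $D_1$ to $D_2$ contains in total at least $\lceil |iu_{S,T}(D_1)-iu_{S,T}(D_2)|/2\rceil$ RII and RIII moves. In particular, if $\mathcal{C}(D_2)\cup\check{\mathcal{C}}(D_2)=\emptyset$, then any such sequence contains in total at least $\lceil |iu_{S,T}(D_1)|/2\rceil$ RII and RIII moves.
   Context: A knot is regarded as a link with one component. Link diagrams lie in the $2$-sphere; links and diagrams are oriented unless otherwise specified. RI, RII, RIII denote the Reidemeister moves of types I, II, III: an RI (resp. RII) move creates or deletes a monogon (resp. bigon) face, and an RIII move is performed on a $3$-gon face, deleting it and creating a new one. Orientations and the numbering of components are carried along by Reidemeister moves, and a sequence deforming $D_1$ to $D_2$ is understood to respect the numbering. $\lceil x\rceil$ is the smallest integer larger than or equal to $x$. Smoothings: at a crossing $x$ of an oriented diagram $D$, cut the link at the two preimage points of $x$, and paste the four short subarcs near the resulting endpoints in a way other than the original one. If the pasting connects orientations consistently this is the (regular) smoothing, and $D_x$ denotes the link represented by the resulting diagram. If the pasting connects orientations inconsistently this is the irregular smoothing, and $\check{D_x}$ denotes the unoriented link represented by the resulting diagram. Unknotting number: for an $m$-component link $K$, $u(K)$ is the minimum number of crossing changes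 in a sequence of Reidemeister moves and crossing changes (crossing changes are allowed at any crossing, between the same or distinct components) deforming a diagram of $K$ into a diagram of the trivial $m$-component link (the link bounding a disjoint union of $m$ disks). Invariant $iu_{S,T}$: let $L$ be an oriented link with components $L_1,\dots,L_n$, $S$ and $T$ symmetric $n\times n$ matrices with entries in $\{-1,0,+1\}$ such that $t_{ij}=0$ iff $s_{ij}=0$, and $D$ a diagram of $L$. Let $\mathcal{C}(D)$ (resp. $\check{\mathcal{C}}(D)$) be the set of crossings of $D$ between subarcs of components $L_i$ and $L_j$ (possibly $i=j$) with $s_{ij}=+1$ (resp. $s_{ij}=-1$). For a crossing $x$ between subarcs of $L_i$ and $L_j$ put $t(x)=t_{ij}$, and let $\mathrm{sign}(x)\in\{\pm1\}$ be the usual sign of the crossing. Then $$iu_{S,T}(D)=\sum_{x\in\mathcal{C}(D)}t(x)\,\mathrm{sign}(x)\,|u(D_x)-u(L)|+\sum_{x\in\check{\mathcal{C}}(D)}t(x)\,\mathrm{sign}(x)\,|u(\check{D_x})-u(L)|,$$ with value $0$ for a diagram with no crossings. *)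

(* Defs.v *)
From mathcomp Require Import all_boot all_order all_algebra.
From mathcomp Require Import boolp classical_sets.
From Stdlib Require Import Relation_Operators.

Set Implicit Arguments.
Unset Strict Implicit.
Unset Printing Implicit Defensive.

Import Order.TTheory GRing.Theory Num.Theory.

(**
  Link diagrams are sliced: a diagram is cut by horizontal lines into slices
  containing one local minimum (Cup), one local maximum (Cap) or one crossing,
  and is recorded as the sequence of its slices, read from bottom to top.
  Horizontal positions are numbered from the left, starting at 0.

  Isotopies of diagrams in the sphere become moves on sequences of slices:
  the generic events of an isotopy of a plane diagram with respect to the
  height function are the exchange of the heights of two distant slices, the
  birth or death of a pair of extrema, and the passage of an extremum through
  a crossing; the 2-sphere rather than the plane is obtained by also letting an
  outermost arc pass through the point at infinity.

  The points of a diagram carry labels. Over [unoriented] a word is an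
  unoriented diagram; over [oriented n] a label is a component number with a
  direction (true for upwards), so that all moves transport orientations and
  numberings. [flip a] is the label seen at the other leg of an extremum.
*)

Record labels := Labels {
  label :> eqType;
  flip : label -> label;
  flipK : involutive flip }.

Definition unoriented : labels := @Labels unit id (fun=> erefl).

Definition flip_direction n (a : 'I_n * bool) := (a.1, ~~ a.2).

Lemma flip_directionK n : involutive (@flip_direction n).
Proof. by case=> i d; rewrite /flip_direction /= negbK. Qed.

Definition oriented n : labels := Labels (@flip_directionK n).

(** [Cup i a] creates a strand at position i, labelled a, and one at i+1;
    [Cap i] joins the strands at i and i+1; [Cross i b] makes them cross, the
    strand going from i to i+1 (bottom left to top right) being the over-strand
    iff b = true. *)
Inductive slice (A : labels) :=
  | Cup of nat & A
  | Cap of nat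
  | Cross of nat & bool.
Arguments Cap {A}.
Arguments Cross {A}.

Notation word A := (seq (slice A)).

Section Diagrams.
Context {A : labels}.
Implicit Types (s : slice A) (st : seq A) (D w : word A).

(** The labels above a slice, from those below it; None if it does not fit. *)
Definition run_slice s st : option (seq A) :=
  match s with
  | Cup i a =>
      if i <= size st then Some (take i st ++ [:: a; flip a] ++ drop i st)
      else None
  | Cap i =>
      if drop i st is a :: b :: st' then
        if b == flip a then Some (take i st ++ st') else None
      else None
  | Cross i _ =>
      if drop i st is a :: b :: st' then Some (take i st ++ [:: b, a & st'])
      else None
  end.

Fixpoint run w st : option (seq A) :=
  if w is s :: w' then obind (run w') (run_slice s st) else Some st.

Definition is_diagram D : Prop := run D [::] = Some [::].

(** The labels met by the horizontal line above the first t slices. *)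
Definition level D t : seq A := odflt [::] (run (take t D) [::]).

(** Points are pairs (t, j): the j-th point of the t-th level. *)
Definition is_point D (p : nat * nat) : bool :=
  (p.1 <= size D) && (p.2 < size (level D p.1)).

Definition label_at D (p : nat * nat) : option A := onth (level D p.1) p.2.

(** Upper end of the strand entering a slice at position j, if any. *)
Definition through s j : option nat :=
  match s with
  | Cup i _ => Some (if j < i then j else j.+2)
  | Cap i => if j < i then Some j else if j < i.+2 then None else Some j.-2
  | Cross i _ => Some (if j == i then i.+1 else if j == i.+1 then i else j)
  end.

Inductive joined D : nat * nat -> nat * nat -> Prop :=
  | joined_through t s j k :
      onth D t = Some s -> is_point D (t, j) -> through s j = Some k ->
      joined D (t, j) (t.+1, k)
  | joined_cup t i a :
      onth D t = Some (Cup i a) -> joined D (t.+1, i) (t.+1, i.+1)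
  | joined_cap t i :
      onth D t = Some (Cap i) -> joined D (t, i) (t, i.+1).

Definition same_component D := clos_refl_sym_trans _ (joined D).

Definition position s :=
  match s with Cup i _ => i | Cap i => i | Cross i _ => i end.

Definition inputs s :=
  match s with Cup _ _ => 0 | Cap _ => 2 | Cross _ _ => 2 end.

Definition outputs s :=
  match s with Cup _ _ => 2 | Cap _ => 0 | Cross _ _ => 2 end.

Definition raise m s : slice A :=
  match s with
  | Cup i a => Cup (m + i) a
  | Cap i => Cap (m + i)
  | Cross i b => Cross (m + i) b
  end.

End Diagrams.

Inductive move := Isotopy | RI | RII | RIII | CrossingChange.

Definition is_RII_or_RIII m :=
  match m with RII | RIII => true | _ => false end.

Definition is_crossing_change m :=
  match m with CrossingChange => true | _ => false end.

(** Reidemeister moves are listed for one position of the monogon, bigon or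
    3-gon; any other position is isotopic to it. *)
Inductive local_move (A : labels) : move -> word A -> word A -> Prop :=
  | exchange s s' : position s <= position s' ->
      local_move Isotopy [:: s; raise (outputs s) s'] [:: raise (inputs s) s'; s]
  | zigzag_left i a : local_move Isotopy [:: Cup i a; Cap i.+1] [::]
  | zigzag_right i a : local_move Isotopy [:: Cup i.+1 a; Cap i] [::]
  | cup_slide i a b :
      local_move Isotopy [:: Cup i a; Cross i.+1 b] [:: Cup i.+1 a; Cross i (~~ b)]
  | cap_slide i b :
      local_move Isotopy [:: Cross i.+1 b; Cap i] [:: Cross i (~~ b); Cap i.+1]
  | reidemeister1 i a b :
      local_move RI [:: Cup i a; Cross i b] [:: Cup i (flip a)]
  | reidemeister2 i b :
      local_move RII [:: Cross i b; Cross i (~~ b)] [::]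
  (** With strands p, q, r from left to right below the slices, b says whether
      p is over q, c whether p is over r, d whether q is over r. The condition
      excludes the two cyclic patterns. *)
  | reidemeister3 i b c d : ~~ ((b == d) && (c != b)) ->
      local_move RIII [:: Cross i b; Cross i.+1 c; Cross i d]
                      [:: Cross i.+1 d; Cross i c; Cross i.+1 b]
  | crossing_change i b :
      local_move CrossingChange [:: Cross i b] [:: Cross i (~~ b)].

Inductive elementary (A : labels) : move -> word A -> word A -> Prop :=
  | apply_local m u l r v : local_move m l r ->
      elementary m (u ++ l ++ v) (u ++ r ++ v)
  (** The arc closing a (1,1)-tangle on its left is moved through infinity to
      its right. *)
  | through_infinity a w : run w [:: a] = Some [:: a] ->
      elementary Isotopy (Cup 0 (flip a) :: map (raise 1) w ++ [:: Cap 0])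
                         (Cup 0 a :: w ++ [:: Cap 0]).

Definition step (A : labels) m (D D' : word A) : Prop :=
  [/\ is_diagram D, is_diagram D' & elementary m D D' \/ elementary m D' D].

(** The moves ms, performed in this order, can transform D into D'. *)
Fixpoint deforms (A : labels) (ms : seq move) (D D' : word A) : Prop :=
  if ms is m :: ms' then exists2 E, step m D E & deforms ms' E D'
  else is_diagram D /\ D = D'.

Definition reidemeister_sequence (ms : seq move) : bool :=
  ~~ has is_crossing_change ms.

Definition link_of (A : labels) (D D' : word A) : Prop :=
  exists2 ms, reidemeister_sequence ms & deforms ms D D'.

(** Oriented diagram with n components, numbered by their labels. Two points of
    one component always carry the same number. *)
Definition is_numbered_diagram n (D : word (oriented n)) : Prop :=
  [/\ is_diagram D,
      forall i : 'I_n, exists p d, label_at D p = Some (i, d)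
    & forall p q i d e, label_at D p = Some (i, d) ->
        label_at D q = Some (i, e) -> same_component D p q].

Definition is_oriented_link n (L : word (oriented n) -> Prop) : Prop :=
  exists2 D, is_numbered_diagram D & forall D', L D' <-> link_of D D'.

Definition forget n (D : word (oriented n)) : word unoriented :=
  map (fun s => match s with
                | Cup i _ => Cup i (tt : unoriented)
                | Cap i => Cap i
                | Cross i b => Cross i b
                end) D.

Definition circles m : word unoriented :=
  flatten (nseq m [:: Cup 0 (tt : unoriented); Cap 0]).

(** The number m of components is necessarily that of K, as no move changes
    it. *)
Definition unknotted_by (K : word unoriented -> Prop) (k : nat) : Prop :=
  exists D ms E m, [/\ K D, deforms ms D E, link_of (circles m) E
                     & count is_crossing_change ms = k].

(** The set of all such k is nonempty for every link; the default 0 is never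
    used. *)
Definition unknotting_number (K : word unoriented -> Prop) : nat :=
  xget 0 [set k | unknotted_by K k /\ forall j, unknotted_by K j -> k <= j].

(** The crossing in the slice number [slice_of], between the strands leaving
    [position_of] and the next position upwards, labelled [left_of] and
    [right_of]. *)
Record crossing n := Crossing {
  slice_of : nat;
  position_of : nat;
  over_of : bool;
  left_of : 'I_n * bool;
  right_of : 'I_n * bool }.

Definition crossing_at n (D : word (oriented n)) t : option (crossing n) :=
  if onth D t is Some (Cross i b) then
    if (label_at D (t, i), label_at D (t, i.+1)) is (Some p, Some q) then
      Some (Crossing t i b p q)
    else None
  else None.

Definition crossings n (D : word (oriented n)) : seq (crossing n) :=
  pmap (crossing_at D) (iota 0 (size D)).

Definition parallel n (x : crossing n) : bool := (left_of x).2 == (right_of x).2.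

Local Open Scope ring_scope.

Definition crossing_sign n (x : crossing n) : int :=
  if over_of x == parallel x then 1 else -1.

(** Entry of a symmetric matrix at the components meeting in x. *)
Definition entry n (M : 'M[int]_n) (x : crossing n) : int :=
  M (left_of x).1 (right_of x).1.

Definition replace_slice (D : word unoriented) t (w : word unoriented) :=
  take t D ++ w ++ drop t.+1 D.

Definition vertical_smoothing n (D : word (oriented n)) (x : crossing n) :=
  replace_slice (forget D) (slice_of x) [::].

Definition horizontal_smoothing n (D : word (oriented n)) (x : crossing n) :=
  replace_slice (forget D) (slice_of x)
    [:: Cap (position_of x); Cup (position_of x) (tt : unoriented)].

(** The orientation of the regular smoothing is dropped, unknotting numbers
    being defined on unoriented links. *)
Definition regular_smoothing n (D : word (oriented n)) (x : crossing n) :=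
  if parallel x then vertical_smoothing D x else horizontal_smoothing D x.

Definition irregular_smoothing n (D : word (oriented n)) (x : crossing n) :=
  if parallel x then horizontal_smoothing D x else vertical_smoothing D x.

Definition regular_crossings n (S : 'M[int]_n) (D : word (oriented n)) :=
  [seq x <- crossings D | entry S x == 1].

Definition irregular_crossings n (S : 'M[int]_n) (D : word (oriented n)) :=
  [seq x <- crossings D | entry S x == -1].

Definition u (D : word unoriented) : int := (unknotting_number (link_of D))%:Z.

Definition iu n (S T : 'M[int]_n) (D : word (oriented n)) : int :=
  \sum_(x <- regular_crossings S D)
     entry T x * crossing_sign x * `|u (regular_smoothing D x) - u (forget D)|
  + \sum_(x <- irregular_crossings S D)
     entry T x * crossing_sign x * `|u (irregular_smoothing D x) - u (forget D)|.

(* Main.v *)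
Require Import Defs.
From mathcomp Require Import all_boot all_order all_algebra.
From mathcomp Require Import boolp classical_sets.
From mathcomp Require Import zify.

(**
  A change of diagram matters to iu only through the crossings and the unknotting
  numbers of their smoothings, and |u(D) - u(E)| <= k as soon as k crossing changes
  turn D into E.  A crossing created or deleted by an RI move has smoothings L and
  L plus a trivial circle, both with unknotting number u(L), so its term is 0; that
  the circle does not lower u is seen by deleting it from an unlinking sequence.
  The two crossings of an RII bigon have opposite signs, and their smoothings agree
  or differ by one crossing change, so iu moves by at most 1.  In an RIII move two of
  the three smoothed pairs are equivalent; for the crossing of the top and bottom
  strands the middle strand forms a clasp on each side, and two crossing changes
  suffice, so iu moves by at most 2.
*)

Import Order.TTheory GRing.Theory Num.Theory.

Set Implicit Arguments.
Unset Strict Implicit.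
Unset Printing Implicit Defensive.

(** * Runs of words *)

(** An irregular smoothing destroys directions and any smoothing may merge components, so unknotting
    numbers are compared on unlabelled words, where fitting depends only on the number of points of
    each level. To localize iu, the sum is read along the word: a term depends on the diagram only
    through the map [U] that sends a filling of a hole to its unknotting number. Outside the factor
    touched by a move the smoothed diagrams differ by that same move, so these terms cancel and
    finitely many shapes remain. Isotopies need this analysis too, since a slide turns a crossing by
    a quarter and exchanges its two smoothings. Deleting the extra circle requires following one
    component through an arbitrary unlinking sequence, crossing changes with other components
    included. For this the sequence is lifted to diagrams whose components carry a mark; after
    deletion each move survives or becomes trivial, so no crossing change is added. *)

Section Prefix.
Variable T : Type.
Implicit Types x y z : seq T.

Lemma drop_prefix x y k : drop (size x + k) (x ++ y) = drop k y.
Proof. by rewrite addnC -drop_drop drop_size_cat. Qed.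

Lemma take_prefix x y k : take (size x + k) (x ++ y) = x ++ take k y.
Proof. by rewrite takeD take_size_cat // drop_size_cat. Qed.

Lemma drop_pre0 x y : drop (size x) (x ++ y) = y.
Proof. exact: drop_size_cat. Qed.

Lemma take_pre0 x y : take (size x) (x ++ y) = x.
Proof. exact: take_size_cat. Qed.

Lemma drop_pre1 x y : drop (size x).+1 (x ++ y) = drop 1 y.
Proof. by rewrite -addn1 drop_prefix. Qed.

Lemma take_pre1 x y : take (size x).+1 (x ++ y) = x ++ take 1 y.
Proof. by rewrite -addn1 take_prefix. Qed.

Lemma size_pre0 x y : size x <= size (x ++ y).
Proof. by rewrite size_cat leq_addr. Qed.

Lemma size_pre1 x y : (size x < size (x ++ y)) = (0 < size y).
Proof. by rewrite size_cat -{1}[size x]addn0 ltn_add2l. Qed.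

Lemma split_at (st : seq T) i : i <= size st ->
  exists x y, st = x ++ y /\ size x = i.
Proof.
by move=> hi; exists (take i st), (drop i st); rewrite cat_take_drop size_takel.
Qed.

End Prefix.

Definition preE := (drop_pre0, take_pre0, drop_pre1, take_pre1, size_pre0, size_pre1).

(** Evaluates a run of slices at positions i and i.+1 on the labels st. *)
Ltac compute_run i st :=
  let x := fresh "x" in let y := fresh "y" in let lt := fresh "lt" in
  let e := fresh "e" in let e' := fresh "e" in
  case: (leqP i (size st)) => [/split_at[x [y [-> <-]]]|lt] /=;
  [ case: y => [|? [|? [|? ?]]] /=; do 5! rewrite ?preE -?catA /=;
    rewrite ?take0 ?drop0 ?flipK //
  | have e : (i <= size st) = false by [lia]; have e' : (i < size st) = false by [lia];
    by rewrite ?e ?e' ?(drop_oversize (ltnW lt)) ?(drop_oversize (leqW (ltnW lt))) ].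

Section Runs.
Variable A : labels.
Implicit Types (s : slice A) (w : word A) (st x y : seq A).

Lemma run_cat w1 w2 st : run (w1 ++ w2) st = obind (run w2) (run w1 st).
Proof.
elim: w1 st => [|s w1 IH] st //=.
by case: (run_slice s st) => //= st'.
Qed.

(** Inversion form of [run_slice]: cutting the labels at the position of the slice turns [take] and
    [drop] into concatenations. *)
Variant fits : slice A -> seq A -> seq A -> Prop :=
  | fits_cup x y a : fits (Cup (size x) a) (x ++ y) (x ++ a :: flip a :: y)
  | fits_cap x y a : fits (Cap (size x)) (x ++ a :: flip a :: y) (x ++ y)
  | fits_cross x y b p q :
      fits (Cross (size x) b) (x ++ p :: q :: y) (x ++ q :: p :: y).

Lemma run_slice_fits s st st' : run_slice s st = Some st' -> fits s st st'.
Proof.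
case: s => [i a|i|i b] /=.
- case: leqP => // /split_at[x [y [-> <-]]]; rewrite !preE => -[<-].
  exact: fits_cup.
- case: (leqP i (size st)) => [/split_at[x [y [-> <-]]]|/ltnW/drop_oversize -> //].
  rewrite !preE; case: y => [|p [|q y]] //; case: eqP => // -> [<-].
  exact: fits_cap.
- case: (leqP i (size st)) => [/split_at[x [y [-> <-]]]|/ltnW/drop_oversize -> //].
  rewrite !preE; case: y => [|p [|q y]] // [<-]; exact: fits_cross.
Qed.

Lemma run_slice_frame s st st' x y : run_slice s st = Some st' ->
  run_slice (raise (size x) s) (x ++ st ++ y) = Some (x ++ st' ++ y).
Proof.
move=> /run_slice_fits; case=> [z t a|z t a|z t b p q] /=;
  rewrite -size_cat -!catA /= !(catA x z) /= !preE //.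
by rewrite eqxx.
Qed.

Lemma run_frame w st st' x y : run w st = Some st' ->
  run (map (raise (size x)) w) (x ++ st ++ y) = Some (x ++ st' ++ y).
Proof.
elim: w st => [|s w IH] st /=; first by case=> ->.
case E: (run_slice s st) => [st1|] //= /IH <-.
by rewrite (run_slice_frame x y E).
Qed.

Lemma raise0 s : raise 0 s = s.
Proof. by case: s. Qed.

Lemma map_raise0 w : map (raise 0) w = w.
Proof. by rewrite -[RHS]map_id; apply: eq_map => s; rewrite raise0. Qed.

Lemma raiseD i j s : raise i (raise j s) = raise (i + j) s.
Proof. by case: s => *; rewrite /= addnA. Qed.

Definition base s : slice A :=
  match s with Cup _ a => Cup 0 a | Cap _ => Cap 0 | Cross _ b => Cross 0 b end.

Lemma raise_base s : raise (position s) (base s) = s.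
Proof. by case: s => *; rewrite /= addn0. Qed.

Lemma run_slice_split s st st' : run_slice s st = Some st' ->
  exists x P Q y, [/\ st = x ++ P ++ y, st' = x ++ Q ++ y, size x = position s,
    size P = inputs s /\ size Q = outputs s & run_slice (base s) P = Some Q].
Proof.
move=> /run_slice_fits; case=> [x y a|x y a|x y b p q] /=.
- by exists x, [::], [:: a; flip a], y.
- by exists x, [:: a; flip a], [::], y; rewrite /= eqxx.
- by exists x, [:: p; q], [:: q; p], y.
Qed.

Lemma run_slice_size s st st' : run_slice s st = Some st' ->
  position s + inputs s <= size st /\ size st' + inputs s = size st + outputs s.
Proof.
by move/run_slice_fits; case=> *; rewrite /= !size_cat /=; split; lia.
Qed.

(** Order-free description of two distant slices: [s] turns the block [P] into [Q], while [s'] acts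
    on the labels [y] to the right of it. Both sides of an exchange are shown equivalent to it. *)
Variant exchangeable s s' st st1 : Prop :=
  | Exchangeable x P Q y y' of st = x ++ P ++ y & st1 = x ++ Q ++ y' &
      size x = position s & size P = inputs s & size Q = outputs s &
      run_slice (base s) P = Some Q &
      run_slice (raise (position s' - position s) (base s')) y = Some y'.

Lemma exchange_offset s s' m : position s <= position s' ->
  raise m s' =
    raise (position s + m) (raise (position s' - position s) (base s')).
Proof.
move=> le; rewrite raiseD addnAC subnKC // addnC -raiseD raise_base //.
Qed.

Lemma run_slice_pre s x y : run_slice (raise (size x) s) (x ++ y) =
  omap (cat x) (run_slice s y).
Proof.
case E: (run_slice s y) => [y'|] /=.
  by have := run_slice_frame x [::] E; rewrite !cats0.
case: s E => [i a|i|i b] /=; rewrite ?size_cat ?leq_add2l ?drop_prefix.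
- by case: leqP.
- by case: (drop i y) => [|p [|q z]] //; case: eqP.
- by case: (drop i y) => [|p [|q z]].
Qed.

Lemma exchangePl s s' st st1 : position s <= position s' ->
  run [:: s; raise (outputs s) s'] st = Some st1 <-> exchangeable s s' st st1.
Proof.
move=> le; split=> /=.
- case E: (run_slice s st) => [st2|] //=.
  have [x [P [Q [y [-> E2 sx [sP sQ] EP]]]]] := run_slice_split E.
  rewrite {}E2 catA (exchange_offset _ le) -sx -sQ -size_cat run_slice_pre.
  rewrite {1}sx; case E': run_slice => [y'|] //= [<-].
  by apply: (@Exchangeable _ _ _ _ x P Q y y'); rewrite ?catA.
- case=> x P Q y y' -> -> sx sP sQ EP Ey.
  have := run_slice_frame x y EP; rewrite {1}sx raise_base => -> /=.
  by rewrite (exchange_offset _ le) -{1}sx -sQ -size_cat catA run_slice_pre Ey /= -catA.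
Qed.

Lemma exchangePr s s' st st1 : position s <= position s' ->
  run [:: raise (inputs s) s'; s] st = Some st1 <-> exchangeable s s' st st1.
Proof.
move=> le; split=> /=.
- case E: (run_slice _ st) => [st2|] //=.
  have : position s + inputs s <= size st.
    apply: leq_trans (run_slice_size E).1.
    by rewrite (_ : position (raise _ _) = inputs s + position s'); [lia | case: (s')].
  case/split_at=> z [y [Est sz]]; subst st.
  move: E; rewrite (exchange_offset _ le) -sz run_slice_pre.
  case Ey: run_slice => [y'|] //= [<-]; case E: (run_slice s _) => [st3|] //= [E3].
  have [x [P [Q [y2 [E1 E2 sx [sP sQ] EP]]]]] := run_slice_split E.
  move/eqP: E1; rewrite catA eqseq_cat; last by rewrite size_cat sz sx sP.
  case/andP=> /eqP ? /eqP ?; subst z y2.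
  by apply: (@Exchangeable _ _ _ _ x P Q y y'); rewrite -?E3 ?E2 ?catA.
- case=> x P Q y y' -> -> sx sP sQ EP Ey.
  rewrite (exchange_offset _ le) -{1}sx -sP -size_cat catA run_slice_pre Ey /= -catA.
  by have := run_slice_frame x y' EP; rewrite {1}sx raise_base => ->.
Qed.

(** Only this direction holds: a zigzag or a bigon requires strands, and a zigzag also a matching
    label, that the empty word does not ask for. *)
Lemma run_local m l r st st1 : @local_move A m l r ->
  run l st = Some st1 -> run r st = Some st1.
Proof.
case=> [s s' le|i a|i a|i a b|i b|i a b|i b|i b c d _|i b].
- by rewrite exchangePr // exchangePl.
all: compute_run i st.
all: by case: eqP => [->|]; rewrite ?flipK.
Qed.
End Runs.

(** * Unlabelled words: fitting decided by numbers of points *)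

Section Heights.
Variable A : labels.
Implicit Types (s : slice A) (w : word A) (st : seq A).

Definition slice_height s k : option nat :=
  match s with
  | Cup i _ => if i <= k then Some k.+2 else None
  | Cap i => if i.+1 < k then Some k.-2 else None
  | Cross i _ => if i.+1 < k then Some k else None
  end.

Fixpoint height w k : option nat :=
  if w is s :: w' then obind (height w') (slice_height s k) else Some k.

Lemma height_cat w1 w2 k : height (w1 ++ w2) k = obind (height w2) (height w1 k).
Proof. by elim: w1 k => [|s w1 IH] k //=; case: (slice_height s k). Qed.

Lemma slice_height_run s st st' :
  run_slice s st = Some st' -> slice_height s (size st) = Some (size st').
Proof.
move/run_slice_fits; case=> * /=; rewrite !size_cat /=.
- by rewrite leq_addr !addnS.
- by rewrite !addnS !ltnS leq_addr.
- by rewrite !addnS !ltnS leq_addr.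
Qed.

Lemma height_run w st st' :
  run w st = Some st' -> height w (size st) = Some (size st').
Proof.
elim: w st => [|s w IH] st /=; first by case=> ->.
by case E: (run_slice s st) => [st1|] //= /IH <-; rewrite (slice_height_run E).
Qed.

(** Counterpart of [forget] for all labels, convertible to it over [oriented n]; the marked labels
    of the deletion argument need it as well. *)
Definition strip_slice s : slice unoriented :=
  match s with
  | Cup i _ => @Cup unoriented i tt
  | Cap i => Cap i
  | Cross i b => Cross i b
  end.

Definition strip w : word unoriented := map strip_slice w.

Lemma strip_cat w1 w2 : strip (w1 ++ w2) = strip w1 ++ strip w2.
Proof. exact: map_cat. Qed.

Lemma strip_raise m s : strip_slice (raise m s) = raise m (strip_slice s).
Proof. by case: s. Qed.

Lemma strip_map_raise m w : strip (map (raise m) w) = map (raise m) (strip w).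
Proof. by rewrite /strip -!map_comp; apply: eq_map => s; rewrite /= strip_raise. Qed.

Lemma strip_slice_inputs s : inputs (strip_slice s) = inputs s.
Proof. by case: s. Qed.

Lemma strip_slice_outputs s : outputs (strip_slice s) = outputs s.
Proof. by case: s. Qed.

Lemma strip_slice_position s : position (strip_slice s) = position s.
Proof. by case: s. Qed.

End Heights.

Lemma height_strip (A : labels) (w : word A) k : height (strip w) k = height w k.
Proof.
elim: w k => [|s w IH] k //=.
have -> : slice_height (strip_slice s) k = slice_height s k by case: s.
by case: (slice_height s k) => //= k'.
Qed.

Local Notation uword := (word unoriented).

Definition points k : seq unoriented := nseq k (tt : unoriented).

Lemma points_size (st : seq unoriented) k : size st = k -> st = points k.
Proof. by move<-; elim: st => [|[] st IH] //=; rewrite {1}IH. Qed.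

Lemma run_points (w : uword) k : run w (points k) = omap points (height w k).
Proof.
case E: (run w (points k)) => [st|].
  by move/height_run: E; rewrite size_nseq => -> /=; congr Some; exact: points_size.
case H: (height w k) => [k'|] //=.
elim: w k H E => [|s w IH] k //=.
case Es: (slice_height s k) => [k1|] //= H.
suff -> : run_slice s (points k) = Some (points k1) by exact: IH.
case: s Es => [i []|i|i b] /=; case: leqP => // lt [<-].
- rewrite size_nseq lt; congr Some; apply: points_size.
  by rewrite size_cat /= size_drop size_takel size_nseq //; lia.
- have: size (drop i (points k)) = k - i by rewrite size_drop size_nseq.
  have st: size (take i (points k)) = i by rewrite size_takel // size_nseq; lia.
  case: (drop _ _) => [|p [|q y]] //=; try lia; move=> sy.
  case: p q => [] [] /=.
  have {}sy : size y = (k - i).-2 by rewrite -sy.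
  by congr Some; apply: points_size; rewrite size_cat st sy; lia.
- have: size (drop i (points k)) = k - i by rewrite size_drop size_nseq.
  have st: size (take i (points k)) = i by rewrite size_takel // size_nseq; lia.
  case: (drop _ _) => [|p [|q y]] //=; try lia; move=> sy.
  have {}sy : size y = (k - i).-2 by rewrite -sy.
  by congr Some; apply: points_size; rewrite size_cat st /= sy; lia.
Qed.

Lemma is_diagram_height (D : uword) : is_diagram D <-> height D 0 = Some 0.
Proof.
rewrite /is_diagram (run_points D 0).
case: (height D 0) => [[|k]|] //.
Qed.

(** * Deformations with a bounded number of crossing changes *)

Section Deformations.
Variable A : labels.
Implicit Types (D E : word A).

Lemma step_sym m D E : step m D E -> step m E D.
Proof. by case=> dD dE h; split=> //; case: h; [right|left]. Qed.

Lemma deforms_cat ms1 ms2 D1 D2 D3 :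
  deforms ms1 D1 D2 -> deforms ms2 D2 D3 -> deforms (ms1 ++ ms2) D1 D3.
Proof.
elim: ms1 D1 => [|m ms IH] D1 /=; first by case=> _ ->.
by case=> E s d d'; exists E => //; exact: IH.
Qed.

Lemma deforms_diagram ms D1 D2 : deforms ms D1 D2 -> is_diagram D1 /\ is_diagram D2.
Proof.
elim: ms D1 => [|m ms IH] D1 /=; first by case=> d <-.
by case=> E [dD _ _] /IH[].
Qed.

Lemma deforms_rev ms D1 D2 : deforms ms D1 D2 -> deforms (rev ms) D2 D1.
Proof.
elim: ms D1 => [|m ms IH] D1 /=; first by case=> d <-.
case=> E s /IH d; rewrite rev_cons -cats1; apply: (deforms_cat d).
by exists D1; [exact: step_sym | split=> //; case: s].
Qed.

(** With c = 0 this is equivalence under Reidemeister moves and isotopies. *)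
Definition close c D E := exists2 ms, deforms ms D E & count is_crossing_change ms <= c.

Lemma close_refl D : is_diagram D -> close 0 D D.
Proof. by exists [::]. Qed.

Lemma close_sym c D E : close c D E -> close c E D.
Proof. by case=> ms /deforms_rev d le; exists (rev ms); rewrite ?count_rev. Qed.

Lemma close_trans c1 c2 D1 D2 D3 : close c1 D1 D2 -> close c2 D2 D3 ->
    close (c1 + c2) D1 D3.
Proof.
move=> [m1 d1 l1] [m2 d2 l2]; exists (m1 ++ m2); first exact: deforms_cat d1 d2.
by rewrite count_cat leq_add.
Qed.

Lemma close_trans0 c D1 D2 D3 : close 0 D1 D2 -> close c D2 D3 -> close c D1 D3.
Proof. by move=> h1 h2; have := close_trans h1 h2. Qed.

Lemma close_diagram c D E : close c D E -> is_diagram D /\ is_diagram E.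
Proof. by case=> ms /deforms_diagram. Qed.

Lemma close_leq c c' D E : c <= c' -> close c D E -> close c' D E.
Proof. by move=> le [ms d l]; exists ms => //; exact: leq_trans le. Qed.

Lemma step_close m D E : step m D E -> close (is_crossing_change m) D E.
Proof. by move=> s; exists [:: m]; rewrite /= ?addn0 //; exists E => //; split=> //;
    case: s. Qed.

End Deformations.

(** [tclose c k l r]: at height k, l can be replaced with r in any diagram at
    the cost of at most c crossing changes. *)
Definition tclose c k (l r : uword) :=
  height l k = height r k /\
  forall u v, height u 0 = Some k -> is_diagram (u ++ l ++ v) ->
      close c (u ++ l ++ v) (u ++ r ++ v).

Lemma tclose_refl k (l : uword) : tclose 0 k l l.
Proof. by split=> // u v _; exact: close_refl. Qed.

Lemma tclose_diagram k (l r u v : uword) : height l k = height r k ->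
    height u 0 = Some k ->
  is_diagram (u ++ l ++ v) -> is_diagram (u ++ r ++ v).
Proof.
move=> e h /is_diagram_height d; apply/is_diagram_height; move: d.
by rewrite !height_cat h /= !height_cat e.
Qed.

Lemma tclose_sym c k l r : tclose c k l r -> tclose c k r l.
Proof.
case=> e h; split=> // u v hu /(tclose_diagram (esym e) hu) d.
exact/close_sym/h.
Qed.

Lemma tclose_trans c1 c2 k l m r : tclose c1 k l m -> tclose c2 k m r ->
    tclose (c1 + c2) k l r.
Proof.
move=> [e1 h1] [e2 h2]; split=> [|u v hu d]; first by rewrite e1.
have h := h1 _ _ hu d; apply: (close_trans h); apply: h2 => //.
by have [] := close_diagram h.
Qed.

Lemma tclose_trans0 c k l m r : tclose 0 k l m -> tclose c k m r -> tclose c k l r.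
Proof. exact: tclose_trans. Qed.

Lemma tclose_leq c c' k l r : c <= c' -> tclose c k l r -> tclose c' k l r.
Proof. by move=> le [e h]; split=> // u v hu d; apply: close_leq le _; exact: h. Qed.

Lemma tclose_ctx p s c k l r : (forall k', height p k = Some k' -> tclose c k' l r) ->
  tclose c k (p ++ l ++ s) (p ++ r ++ s).
Proof.
move=> h; split=> [|u v hu d].
  rewrite !height_cat; case E: (height p k) => [k'|] //=.
  by rewrite !height_cat (h _ E).1.
case E: (height p k) => [k'|]; last first.
  by move/is_diagram_height: d; rewrite !height_cat hu /= !height_cat E.
have := (h _ E).2 (u ++ p) (s ++ v); rewrite height_cat hu /= E -!catA; apply=> //.
by move: d; rewrite -!catA.
Qed.

Lemma tclose_local m l r k : @local_move unoriented m l r -> height l k = height r k ->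
  tclose (is_crossing_change m) k l r.
Proof.
move=> lr e; split=> // u v hu d; apply: step_close; split=> //.
  exact: tclose_diagram e hu d.
by left; exact: apply_local.
Qed.

(** * Calculus of unoriented tangles *)

Local Notation UCup i := (@Cup unoriented i tt).

Ltac heights :=
  rewrite /=; repeat (case: ifP => /= ?); try done; try (exfalso; lia);
      try (congr Some; lia).

(** Rewrites the factor l of a tangle p ++ l ++ s to r. *)
Tactic Notation "tstep" uconstr(p) uconstr(l) uconstr(r) uconstr(s) :=
  refine (@tclose_trans0 _ _ _ (p ++ r ++ s) _ _ _);
  [ refine (@tclose_ctx p s 0 _ l r _) => ? /=;
    (repeat case: ifP => /= ?); move=> // -[<-] | ].

Lemma tclose_exchange k (s s' : slice unoriented) : position s <= position s' ->
  tclose 0 k [:: s; raise (outputs s) s'] [:: raise (inputs s) s'; s].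
Proof.
move=> le; apply: (tclose_local (exchange le)).
by case: s s' le => [i a|i|i b] [j a'|j|j b'] /= le; heights.
Qed.

Lemma tclose_zigzag_left i k : i < k -> tclose 0 k [:: UCup i; Cap i.+1] [::].
Proof. by move=> lt; apply: (tclose_local (zigzag_left i _)); heights. Qed.

Lemma tclose_zigzag_right i k : i < k -> tclose 0 k [:: UCup i.+1; Cap i] [::].
Proof. by move=> lt; apply: (tclose_local (zigzag_right i _)); heights. Qed.

Lemma tclose_cup_slide i b k :
  tclose 0 k [:: UCup i; Cross i.+1 b] [:: UCup i.+1; Cross i (~~ b)].
Proof. by apply: (tclose_local (cup_slide i _ b)); heights. Qed.

Lemma tclose_cap_slide i b k :
  tclose 0 k [:: Cross i.+1 b; Cap i] [:: Cross i (~~ b); Cap i.+1].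
Proof. by apply: (tclose_local (@cap_slide unoriented i b)); heights. Qed.

Lemma tclose_RI_cup i b k : tclose 0 k [:: UCup i; Cross i b] [:: UCup i].
Proof. by apply: (tclose_local (@reidemeister1 unoriented i tt b)); heights. Qed.

Lemma tclose_RII i b k : i.+1 < k -> tclose 0 k [:: Cross i b; Cross i (~~ b)] [::].
Proof. by move=> lt; apply: (tclose_local (@reidemeister2 unoriented i b));
    heights. Qed.

Lemma tclose_RII' i b k : i.+1 < k -> tclose 0 k [:: Cross i (~~ b); Cross i b] [::].
Proof. by rewrite -{2}[b]negbK; exact: tclose_RII. Qed.

Lemma tclose_RIII i b c d k : ~~ ((b == d) && (c != b)) ->
  tclose 0 k [:: Cross i b; Cross i.+1 c; Cross i d]
      [:: Cross i.+1 d; Cross i c; Cross i.+1 b].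
Proof. by move=> ok; apply: (tclose_local (@reidemeister3 unoriented i b c d ok));
    heights. Qed.

Lemma tclose_crossing_change i b k : tclose 1 k [:: Cross i b] [:: Cross i (~~ b)].
Proof. by apply: (tclose_local (@crossing_change unoriented i b)); heights. Qed.

(** The listed RI move has its monogon on a minimum. A zigzag supplies such a minimum; the curl made
    there is carried to the maximum by slides and exchanges, and a zigzag is cancelled. *)
Lemma tclose_RI_cap i b k : i.+1 < k -> tclose 0 k [:: Cross i b; Cap i] [:: Cap i].
Proof.
move=> lt; apply: tclose_sym.
tstep [::] [::] [:: UCup i.+2; Cap i.+1] [:: Cap i].
  by apply/tclose_sym/tclose_zigzag_right; lia.
tstep [::] [:: UCup i.+2] [:: UCup i.+2; Cross i.+2 b] [:: Cap i.+1; Cap i].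
  exact/tclose_sym/tclose_RI_cup.
tstep [:: UCup i.+2] [:: Cross i.+2 b; Cap i.+1]
  [:: Cross i.+1 (~~ b); Cap i.+2] [:: Cap i].
  exact: tclose_cap_slide.
tstep [::] [:: UCup i.+2; Cross i.+1 (~~ b)] [:: UCup i.+1; Cross i.+2 b]
    [:: Cap i.+2; Cap i].
  exact/tclose_sym/tclose_cup_slide.
tstep [:: UCup i.+1; Cross i.+2 b] [:: Cap i.+2; Cap i] [:: Cap i; Cap i] [::].
  exact/tclose_sym/(@tclose_exchange _ (Cap i) (Cap i)).
tstep [:: UCup i.+1] [:: Cross i.+2 b; Cap i] [:: Cap i; Cross i b] [:: Cap i].
  exact/tclose_sym/(@tclose_exchange _ (Cap i) (Cross i b)).
tstep [::] [:: UCup i.+1; Cap i] [::] [:: Cross i b; Cap i].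
  by apply: tclose_zigzag_right; lia.
exact: tclose_refl.
Qed.

Definition circle i : uword := [:: UCup i; Cap i].

(** The circle crosses the strand on its left: an RII move makes them overlap, both extrema slide
    through the strand, and a second RII move separates them. *)
Lemma circle_left i k : i <= k -> tclose 0 k (circle i) (circle 0).
Proof.
elim: i => [|i IH] lt; first exact: tclose_refl.
tstep [:: UCup i.+1] [::] [:: Cross i (~~ true); Cross i true] [:: Cap i.+1].
  by apply/tclose_sym/tclose_RII'; lia.
tstep [::] [:: UCup i.+1; Cross i (~~ true)] [:: UCup i; Cross i.+1 true]
    [:: Cross i true; Cap i.+1].
  exact/tclose_sym/tclose_cup_slide.
tstep [:: UCup i; Cross i.+1 true] [:: Cross i (~~ false); Cap i.+1]
    [:: Cross i.+1 false; Cap i] [::].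
  exact/tclose_sym/tclose_cap_slide.
tstep [:: UCup i] [:: Cross i.+1 true; Cross i.+1 (~~ true)] [::] [:: Cap i].
  by apply: tclose_RII; lia.
exact/IH/ltnW.
Qed.

(** A leftmost circle is distant from every slice, so its two extrema are exchanged with each slice
    in turn. *)
Lemma circle_down p k : tclose 0 k (p ++ circle 0) (circle 0 ++ p).
Proof.
elim: p k => [|s p IH] k; first exact: tclose_refl.
apply: (@tclose_trans0 _ _ _ ([:: s] ++ circle 0 ++ p)).
  have := @tclose_ctx [:: s] [::] 0 k _ _ (fun k' _ => IH k').
  by rewrite !cats0.
have e1 k' := @tclose_exchange k' (UCup 0) s (leq0n _).
have e2 k' := @tclose_exchange k' (Cap 0) s (leq0n _).
rewrite /= raise0 in e1 e2.
apply: (@tclose_trans0 _ _ _ ([::] ++ [:: UCup 0; raise 2 s] ++ (Cap 0 :: p))).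
  by apply: (@tclose_ctx [::] _ 0 k [:: s; UCup 0]) => k' _; exact/tclose_sym/e1.
apply: (@tclose_ctx [:: UCup 0] p 0 k [:: raise 2 s; Cap 0] [:: Cap 0; s]) => k' _.
exact/tclose_sym/e2.
Qed.

Lemma circle_out i p q k : height p 0 = Some k -> i <= k -> is_diagram (p ++ q) ->
  close 0 (p ++ circle i ++ q) (circle 0 ++ p ++ q).
Proof.
move=> hp le d.
have t : tclose 0 0 (p ++ circle i) (circle 0 ++ p).
  apply: tclose_trans0 (circle_down p 0).
  have := @tclose_ctx p [::] 0 0 (circle i) (circle 0); rewrite !cats0; apply.
  by move=> k'; rewrite hp => -[<-]; exact: circle_left.
have /= := t.2 [::] q erefl; rewrite -!catA; apply.
move/is_diagram_height: d; rewrite height_cat hp /= => d.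
by apply/is_diagram_height; rewrite height_cat hp /= le /= ifT.
Qed.

Lemma close_add_circle c (D E : uword) : close c D E ->
    close c (circle 0 ++ D) (circle 0 ++ E).
Proof.
case=> ms; elim: ms c D => [|m ms IH] c D /=.
  by case=> d <- _; apply: close_leq (leq0n c) _;
      apply/close_refl/is_diagram_height/is_diagram_height.
case=> D1 s d le.
have h : close (is_crossing_change m) (circle 0 ++ D) (circle 0 ++ D1).
  case: s => dD dD1; wlog: D D1 dD dD1 {d} / elementary m D D1 => [H|].
    by case=> e; [apply: H => //; left | apply/close_sym/H => //; left].
  move=> e _; case: e dD dD1 => [m' u l r v lr|a w rw] dD dD1.
    rewrite !catA -(catA (circle 0)) -!catA; apply: step_close; split.
    - by apply/is_diagram_height/is_diagram_height.
    - by apply/is_diagram_height/is_diagram_height.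
    - by left; rewrite !(catA (circle 0)); exact: apply_local.
  case: a rw dD dD1 => rw dD dD1.
  (* A circle below the diagram obstructs the passage through infinity. It is first moved into the
     (1,1)-tangle, which becomes [circle 0 ++ w], and moved out again afterwards. *)
  have c1 := @circle_out 1 [:: UCup 0] _ 2 erefl isT dD.
  have c2 := @circle_out 0 [:: UCup 0] _ 2 erefl isT dD1.
  apply: (close_trans0 (close_sym c1)); apply: (close_trans0 _ c2).
  have rcw : run (circle 0 ++ w) [:: tt : unoriented] = Some [:: tt : unoriented] by [].
  apply: (@step_close _ Isotopy); split; last by left; exact: (through_infinity rcw).
  - exact: (close_diagram c1).1.
  - exact: (close_diagram c2).1.
have le' : is_crossing_change m + count is_crossing_change ms <= c by [].
by apply: close_leq le' _; apply: close_trans h _; apply: IH d _.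
Qed.


Lemma tclose_cup_slide_rev i b k :
  tclose 0 k [:: UCup i.+1; Cross i b] [:: UCup i; Cross i.+1 (~~ b)].
Proof. by apply: tclose_sym; rewrite -{2}[b]negbK; exact: tclose_cup_slide. Qed.

Lemma tclose_cap_slide_rev i b k :
  tclose 0 k [:: Cross i b; Cap i.+1] [:: Cross i.+1 (~~ b); Cap i].
Proof. by apply: tclose_sym; rewrite -{2}[b]negbK; exact: tclose_cap_slide. Qed.

Lemma tclose_cross i b b' k : tclose (b != b') k [:: Cross i b] [:: Cross i b'].
Proof.
case: eqP => [->|]; first exact: tclose_refl.
by case: b b' => [] [] // _; exact: tclose_crossing_change.
Qed.

Lemma tclose_under_cup i b k : i < k ->
  tclose 0 k [:: UCup i; Cross i.+1 b; Cross i b] [:: UCup i.+1].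
Proof.
move=> lt; tstep [::] [:: UCup i; Cross i.+1 b] [:: UCup i.+1; Cross i (~~ b)]
    [:: Cross i b].
  exact: tclose_cup_slide.
tstep [:: UCup i.+1] [:: Cross i (~~ b); Cross i b] [::] [::].
  by apply: tclose_RII'; lia.
exact: tclose_refl.
Qed.

Lemma tclose_under_cup_rev i b k : i < k ->
  tclose 0 k [:: UCup i.+1; Cross i b; Cross i.+1 b] [:: UCup i].
Proof.
move=> lt; tstep [::] [:: UCup i.+1; Cross i b] [:: UCup i; Cross i.+1 (~~ b)]
    [:: Cross i.+1 b].
  exact: tclose_cup_slide_rev.
tstep [:: UCup i] [:: Cross i.+1 (~~ b); Cross i.+1 b] [::] [::].
  by apply: tclose_RII'; lia.
exact: tclose_refl.
Qed.

Lemma tclose_over_cap i b k : i.+2 < k ->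
  tclose 0 k [:: Cross i.+1 b; Cross i b; Cap i.+1] [:: Cap i].
Proof.
move=> lt; tstep [:: Cross i.+1 b] [:: Cross i b; Cap i.+1]
    [:: Cross i.+1 (~~ b); Cap i] [::].
  exact: tclose_cap_slide_rev.
tstep [::] [:: Cross i.+1 b; Cross i.+1 (~~ b)] [::] [:: Cap i].
  by apply: tclose_RII; lia.
exact: tclose_refl.
Qed.

Lemma tclose_over_cap_rev i b k : i.+2 < k ->
  tclose 0 k [:: Cross i b; Cross i.+1 b; Cap i] [:: Cap i.+1].
Proof.
move=> lt; tstep [:: Cross i b] [:: Cross i.+1 b; Cap i] [:: Cross i (~~ b); Cap i.+1]
    [::].
  exact: tclose_cap_slide.
tstep [::] [:: Cross i b; Cross i (~~ b)] [::] [:: Cap i.+1].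
  by apply: tclose_RII; lia.
exact: tclose_refl.
Qed.

Tactic Notation "change_crossing" uconstr(p) uconstr(l) uconstr(r) uconstr(s) :=
  refine (@tclose_ctx p s _ _ l r _) => ? _; exact: tclose_cross.

(** One crossing of a 3-gon smoothed, before and after an RIII move. The
    clasp left by the third strand is trivial when that strand passes over or
    under both others; otherwise one crossing change on each side makes it so. *)
Section Smoothed3gon.
Variables (i k : nat) (lt : i.+2 < k).
Implicit Types b c d : bool.

(** [first], [middle] and [last] name the crossing smoothed on the left of the RIII move; the right
    side has the crossings in the opposite order. The endings [v] and [h] stand for the vertical and
    horizontal smoothing. *)
Lemma smooth_first_v c d : tclose ((c != d) + (c != d)) k
  [:: Cross i.+1 c; Cross i d] [:: Cross i.+1 d; Cross i c].
Proof.
apply: (@tclose_trans _ _ _ _ [:: Cross i.+1 d; Cross i d]).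
  change_crossing [::] [:: Cross i.+1 c] [:: Cross i.+1 d] [:: Cross i d].
rewrite eq_sym.
change_crossing [:: Cross i.+1 d] [:: Cross i d] [:: Cross i c] [::].
Qed.

Lemma smooth_first_h c d : tclose ((c != d) + (c != d)) k
  [:: Cap i; UCup i; Cross i.+1 c; Cross i d]
  [:: Cross i.+1 d; Cross i c; Cap i.+1; UCup i.+1].
Proof.
apply: (@tclose_trans _ _ _ _ [:: Cap i; UCup i.+1]).
  rewrite -[nat_of_bool _]addn0;
      apply: (@tclose_trans _ _ _ _ [:: Cap i; UCup i; Cross i.+1 c; Cross i c]).
    rewrite eq_sym.
    change_crossing [:: Cap i; UCup i; Cross i.+1 c] [:: Cross i d] [:: Cross i c] [::].
  tstep [:: Cap i] [:: UCup i; Cross i.+1 c; Cross i c] [:: UCup i.+1] [::].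
    by apply: tclose_under_cup; lia.
  exact: tclose_refl.
apply: tclose_sym; rewrite -[nat_of_bool _]addn0;
    apply: (@tclose_trans _ _ _ _ [:: Cross i.+1 d; Cross i d; Cap i.+1; UCup i.+1]).
  change_crossing [:: Cross i.+1 d] [:: Cross i c] [:: Cross i d]
      [:: Cap i.+1; UCup i.+1].
tstep [::] [:: Cross i.+1 d; Cross i d; Cap i.+1] [:: Cap i] [:: UCup i.+1].
  by apply: tclose_over_cap; lia.
exact: tclose_refl.
Qed.

Lemma smooth_last_v b c : tclose ((b != c) + (b != c)) k
  [:: Cross i b; Cross i.+1 c] [:: Cross i c; Cross i.+1 b].
Proof.
apply: (@tclose_trans _ _ _ _ [:: Cross i c; Cross i.+1 c]).
  change_crossing [::] [:: Cross i b] [:: Cross i c] [:: Cross i.+1 c].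
rewrite eq_sym.
change_crossing [:: Cross i c] [:: Cross i.+1 c] [:: Cross i.+1 b] [::].
Qed.

Lemma smooth_last_h b c : tclose ((b != c) + (b != c)) k
  [:: Cross i b; Cross i.+1 c; Cap i; UCup i]
  [:: Cap i.+1; UCup i.+1; Cross i c; Cross i.+1 b].
Proof.
apply: (@tclose_trans _ _ _ _ [:: Cap i.+1; UCup i]).
  rewrite -[nat_of_bool _]addn0;
      apply: (@tclose_trans _ _ _ _ [:: Cross i c; Cross i.+1 c; Cap i; UCup i]).
    change_crossing [::] [:: Cross i b] [:: Cross i c] [:: Cross i.+1 c; Cap i; UCup i].
  tstep [::] [:: Cross i c; Cross i.+1 c; Cap i] [:: Cap i.+1] [:: UCup i].
    by apply: tclose_over_cap_rev; lia.
  exact: tclose_refl.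
apply: tclose_sym; rewrite -[nat_of_bool _]addn0;
    apply: (@tclose_trans _ _ _ _ [:: Cap i.+1; UCup i.+1; Cross i c; Cross i.+1 c]).
  change_crossing [:: Cap i.+1; UCup i.+1; Cross i c] [:: Cross i.+1 b]
      [:: Cross i.+1 c] [::].
tstep [:: Cap i.+1] [:: UCup i.+1; Cross i c; Cross i.+1 c] [:: UCup i] [::].
  by apply: tclose_under_cup_rev; lia.
exact: tclose_refl.
Qed.

Lemma smooth_middle_v b d : tclose ((b == d) + (b == d)) k
  [:: Cross i b; Cross i d] [:: Cross i.+1 d; Cross i.+1 b].
Proof.
have e : (b == d) = (d != ~~ b) by case: b d => [] [].
apply: (@tclose_trans _ _ _ _ [::]).
  rewrite e -[nat_of_bool _]addn0;
      apply: (@tclose_trans _ _ _ _ [:: Cross i b; Cross i (~~ b)]).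
    change_crossing [:: Cross i b] [:: Cross i d] [:: Cross i (~~ b)] [::].
  by apply: tclose_RII; lia.
have {}e : (b == d) = (b != ~~ d) by case: b d {e} => [] [].
apply: tclose_sym; rewrite e -[nat_of_bool _]addn0;
    apply: (@tclose_trans _ _ _ _ [:: Cross i.+1 d; Cross i.+1 (~~ d)]).
  change_crossing [:: Cross i.+1 d] [:: Cross i.+1 b] [:: Cross i.+1 (~~ d)] [::].
by apply: tclose_RII; lia.
Qed.

Lemma smooth_middle_h b d : tclose ((b == d) + (b == d)) k
  [:: Cross i b; Cap i.+1; UCup i.+1; Cross i d]
  [:: Cross i.+1 d; Cap i; UCup i; Cross i.+1 b].
Proof.
have e1 : (b == d) = (~~ b != d) by case: b d => [] [].
have e2 : (b == d) = (~~ d != b) by case: b d {e1} => [] [].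
rewrite {1}e1 e2 {e1 e2}.
(* The slides move the third strand to the other side of the cap and of the cup. They leave the
   crossings [~~ b] and [~~ d], which are the required [d] and [b] exactly when b and d differ. *)
tstep [::] [:: Cross i b; Cap i.+1] [:: Cross i.+1 (~~ b); Cap i]
    [:: UCup i.+1; Cross i d].
  exact: tclose_cap_slide_rev.
tstep [:: Cross i.+1 (~~ b); Cap i] [:: UCup i.+1; Cross i d]
    [:: UCup i; Cross i.+1 (~~ d)] [::].
  exact: tclose_cup_slide_rev.
apply: (@tclose_trans _ _ _ _ [:: Cross i.+1 d; Cap i; UCup i; Cross i.+1 (~~ d)]).
  change_crossing [::] [:: Cross i.+1 (~~ b)] [:: Cross i.+1 d]
      [:: Cap i; UCup i; Cross i.+1 (~~ d)].
change_crossing [:: Cross i.+1 d; Cap i; UCup i] [:: Cross i.+1 (~~ d)]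
    [:: Cross i.+1 b] [::].
Qed.

End Smoothed3gon.

(** * Deletion of components *)

Section Lifts.
Variable A : labels.
Implicit Types (s : slice A) (w : word A) (st : seq A).

Lemma run_pre w x y : run (map (raise (size x)) w) (x ++ y) = omap (cat x) (run w y).
Proof.
elim: w y => [|s w IH] y //=.
by rewrite run_slice_pre; case: (run_slice s y) => //= y'; exact: IH.
Qed.

Lemma run_slice_post s st y z k : run_slice s (st ++ y) = Some z ->
  slice_height s (size st) = Some k -> exists2 st',
      run_slice s st = Some st' & z = st' ++ y.
Proof.
case: s => [i a|i|i b] /= rz; case: ifP => // /[dup] lt; move: rz.
- move=> rz /split_at[x [t [e si]]] _; move: rz; rewrite e -si -catA !preE => -[<-].
  by eexists; first reflexivity; rewrite -!catA.
- move=> rz /ltnW/ltnW/split_at[x [t [e si]]] _; move: lt rz;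
    rewrite e -si -catA !preE size_cat.
  case: t {e} => [|p [|q t]] /=; try lia.
  by move=> _; case: eqP => // _ [<-]; eexists; first reflexivity; rewrite -!catA.
- move=> rz /ltnW/ltnW/split_at[x [t [e si]]] _; move: lt rz;
    rewrite e -si -catA !preE size_cat.
  case: t {e} => [|p [|q t]] /=; try lia.
  by move=> _ [<-]; eexists; first reflexivity; rewrite -!catA.
Qed.

Lemma run_post w st y z k : run w (st ++ y) = Some z ->
  height w (size st) = Some k -> exists2 st', run w st = Some st' & z = st' ++ y.
Proof.
elim: w st => [|s w IH] st /=; first by case=> <- _; exists st.
case E: (run_slice s _) => [z1|] //= rz; case H: (slice_height _ _) => [k1|] //= Hw.
have [st1 r1 e1] := run_slice_post E H.
have sk : k1 = size st1 by move/slice_height_run: r1; rewrite H => -[].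
by rewrite r1 /=; apply: IH; rewrite -?e1 // -sk.
Qed.

Lemma strip_slice_raise_inv s k (s' : slice unoriented) : strip_slice s = raise k s' ->
  exists2 t, s = raise k t & strip_slice t = s'.
Proof.
case: s s' => [i a|i|i b] [j c|j|j c] //= [-> ].
- by move=> <-; exists (Cup j a).
- by exists (Cap j).
- by move=> ->; exists (Cross j c).
Qed.

Lemma strip_raise_inv w k (w' : uword) : strip w = map (raise k) w' ->
  exists2 t, w = map (raise k) t & strip t = w'.
Proof.
elim: w w' => [|s w IH] [|s' w'] //=; first by exists [::].
case=> /strip_slice_raise_inv[t -> <-] /IH[u -> <-]; by exists (t :: u).
Qed.

Lemma strip_cat_inv w (u v : uword) : strip w = u ++ v ->
  exists u' v', [/\ w = u' ++ v', strip u' = u & strip v' = v].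
Proof.
elim: u w => [|s u IH] w /=; first by exists [::], w.
case: w => [|t w] //= [<-] /IH[u' [v' [-> <- <-]]].
by exists (t :: u'), v'.
Qed.

Lemma lift_local m (l r : uword) w st st1 : local_move m l r -> strip w = l ->
  run w st = Some st1 ->
  exists w', [/\ strip w' = r, run w' st = Some st1 & local_move m w w'].
Proof.
move=> lr ew rw; suff [w' [e lw]] : exists w', strip w' = r /\ local_move m w w'.
  by exists w'; split=> //; exact: run_local lw rw.
case: lr ew => [s s' le|i []|i []|i [] b|i b|i [] b|i b|i b c d ok|i b];
  case: w {rw} => [|t1 [|t2 [|t3 [|t4 w]]]] //=.
- case=> e1; subst s; case/strip_slice_raise_inv=> t -> e'; subst s'.
  exists [:: raise (inputs t1) t; t1];
      rewrite strip_slice_outputs /= strip_raise strip_slice_inputs.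
  by split=> //; apply: exchange; rewrite !strip_slice_position in le.
- case: t1 t2 => // j x [] // j' [-> ->]; exists [::]; split=> //; exact: zigzag_left.
- case: t1 t2 => // j x [] // j' [-> ->]; exists [::]; split=> //; exact: zigzag_right.
- case: t1 t2 => // j x [] // j' b' [-> -> ->]; eexists; split; last exact: cup_slide.
  by [].
- case: t1 t2 => // j x [] // j' [-> -> ->]; eexists; split; last exact: cap_slide.
  by [].
- case: t1 t2 => // j x [] // j' b' [-> -> ->]; eexists; split;
    last exact: reidemeister1.
  by [].
- case: t1 t2 => // j x [] // j' x' [-> -> -> ->]; exists [::]; split=> //;
    exact: reidemeister2.
- case: t1 t2 t3 => // j x [] // j1 x1 [] // j2 x2 [-> -> -> -> -> ->].
  by eexists; split; last exact: reidemeister3.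
- case: t1 => // j x [-> ->]; eexists; split; last exact: crossing_change.
  by [].
Qed.

(** Read backwards, a move may create a zigzag or a bigon. The condition on [height] provides the
    strands it is made of, and the label of a new cup is read off its strand. *)
Lemma lift_local_rev m (l r : uword) w st st1 : local_move m l r -> strip w = r ->
  run w st = Some st1 -> height l (size st) <> None ->
  exists w', [/\ strip w' = l, run w' st = Some st1 & local_move m w' w].
Proof.
case=> [s s' le|i []|i []|i [] b|i b|i [] b|i b|i b c d ok|i b];
  case: w => [|t1 [|t2 [|t3 [|t4 w]]]] //=.
- case=> e1 e2 rw _; have [t Et Es'] := strip_slice_raise_inv e1; subst t1 s' s.
  rewrite strip_slice_inputs in rw *.
  exists [:: t2; raise (outputs t2) t].
  have le' : position t2 <= position t
      by rewrite -(strip_slice_position t2) -(strip_slice_position t).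
  rewrite /= strip_slice_outputs strip_raise; split=> //; last exact: exchange.
  by rewrite exchangePl // -exchangePr.
- move=> _ [<-] hn; have lt : i < size st.
    by rewrite ltnNge; apply/negP => ge; apply: hn; heights.
  have [x [y [e sx]]] := split_at (ltnW lt); subst i.
  case: y e lt => [|p y] -> lt; first by rewrite cats0 ltnn in lt.
  exists [:: Cup (size x) p; Cap (size x).+1]; split; last exact: zigzag_left.
    by [].
  rewrite /=; do 3! rewrite ?preE -?catA /=.
  by rewrite ?take0 ?drop0 ?flipK ?eqxx /= ?eqxx ?take0 ?drop0.
- move=> _ [<-] hn; have lt : i < size st.
    by rewrite ltnNge; apply/negP => ge; apply: hn; heights.
  have [x [y [e sx]]] := split_at (ltnW lt); subst i.
  case: y e lt => [|p y] -> lt; first by rewrite cats0 ltnn in lt.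
  exists [:: Cup (size x).+1 (flip p); Cap (size x)]; split; last exact: zigzag_right.
    by [].
  rewrite /=; do 3! rewrite ?preE -?catA /=.
  by rewrite ?take0 ?drop0 ?flipK ?eqxx /= ?eqxx ?take0 ?drop0.

- case: t1 t2 => // j x [] // j' b' [-> -> ->] rw _.
  exists [:: Cup i x; Cross i.+1 b]; split=> //; last exact: cup_slide.
  by rewrite -rw; compute_run i st.
- case: t1 t2 => // j x [] // j' [-> -> ->] rw _.
  exists [:: Cross i.+1 b; Cap i]; split=> //; last exact: cap_slide.
  by rewrite -rw; compute_run i st.
- case: t1 => // j x [->] rw _.
  exists [:: Cup i (flip x); Cross i b]; split=> //.
    by rewrite -rw; compute_run i st.
  by rewrite -{2}[x]flipK; exact: reidemeister1.
- move=> _ [<-] hn; exists [:: Cross i b; Cross i (~~ b)]; split=> //;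
    last exact: reidemeister2.
  have lt : i.+1 < size st.
    by rewrite ltnNge; apply/negP => ge; apply: hn; heights.
  have [x [y [e sx]]] := split_at (ltnW (ltnW lt)); subst i st.
  case: y lt {hn} => [|p [|q y]] lt; rewrite ?size_cat /= in lt; [lia|lia|].
  by do 3! rewrite /= ?preE.
- case: t1 t2 t3 => // j x [] // j1 x1 [] // j2 x2 [-> -> -> -> -> ->] rw _.
  exists [:: Cross i b; Cross i.+1 c; Cross i d]; split=> //; last exact: reidemeister3.
  by rewrite -rw; compute_run i st.
- case: t1 => // j x [-> ->] rw _; exists [:: Cross i b]; split=> //.
  exact: crossing_change.
Qed.

End Lifts.

(** As [flip] is the identity, both legs of an extremum carry the same mark, so a mark belongs to a
    whole component. *)
Definition marked : labels := @Labels bool id (fun=> erefl).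

(** The components labelled true are removed. *)
Section Deletion.
Implicit Types (s : slice marked) (w : word marked) (st : seq marked).

Definition kept st : nat := count negb st.

(** A crossing survives only if both strands do; positions are recounted among the kept points. *)
Definition del_slice s st : uword :=
  match s with
  | Cup i a => if a : bool then [::] else [:: UCup (kept (take i st))]
  | Cap i =>
      if drop i st is a :: _ then
        if a : bool then [::] else [:: Cap (kept (take i st))]
      else [::]
  | Cross i b =>
      if drop i st is p :: q :: _ then
        if (p : bool) || (q : bool) then [::] else [:: Cross (kept (take i st)) b]
      else [::]
  end.

Fixpoint del w st : uword :=
  if w is s :: w' then del_slice s st ++ del w' (odflt [::] (run_slice s st))
  else [::].

Lemma kept_cat st1 st2 : kept (st1 ++ st2) = kept st1 + kept st2.
Proof. exact: count_cat. Qed.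

Lemma del_cat w1 w2 st st1 : run w1 st = Some st1 ->
  del (w1 ++ w2) st = del w1 st ++ del w2 st1.
Proof.
elim: w1 st => [|s w1 IH] st /=; first by case=> ->.
by case: (run_slice s st) => [st2|] //= /IH ->; rewrite catA.
Qed.

Lemma del_slice_frame s st st' x y : run_slice s st = Some st' ->
  del_slice (raise (size x) s) (x ++ st ++ y) = map (raise (kept x)) (del_slice s st).
Proof.
move=> /run_slice_fits; case=> [z t a|z t a|z t b p q] /=;
  rewrite -size_cat -!catA /= !(catA x z) /= !preE //=.
- by case: a => //=; rewrite kept_cat.
- by case: a => //=; rewrite kept_cat.
- by case: ifP => //=; rewrite kept_cat.
Qed.

Lemma del_frame w st st' x y : run w st = Some st' ->
  del (map (raise (size x)) w) (x ++ st ++ y) = map (raise (kept x)) (del w st).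
Proof.
elim: w st => [|s w IH] st //=.
case E: (run_slice s st) => [st1|] //= r1.
by rewrite (run_slice_frame x y E) /= (IH _ r1) map_cat (del_slice_frame x y E).
Qed.

Lemma del_height w st st' : run w st = Some st' ->
  height (del w st) (kept st) = Some (kept st').
Proof.
elim: w st => [|s w IH] st /=; first by case=> ->.
case E: (run_slice s st) => [st1|] //= /IH h; rewrite height_cat.
suff -> : height (del_slice s st) (kept st) = Some (kept st1) by [].
move/run_slice_fits: E => {h}; case=> [z t a|z t a|z t b p q] /=;
  rewrite !preE !kept_cat /=.
- by case: a => //=; rewrite ?leq_addr //=; congr Some; lia.
- by case: a => //=; rewrite ifT /=; [congr Some|]; lia.
- by case: p q => [] [] //=; rewrite ifT /= //; lia.
Qed.

(** A slice either vanishes without changing the number of kept points, or remains with its inputs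
    and outputs all kept; so an exchange remains an exchange or becomes an equality. *)
Lemma del_base s P Q : size P = inputs s -> run_slice (base s) P = Some Q ->
  (del_slice (base s) P = [::] /\ kept P = kept Q) \/
  exists t, [/\ del_slice (base s) P = [:: t], position t = 0, inputs t = kept P
               & outputs t = kept Q].
Proof.
case: s => [i a|i|i b]; case: P => [|p [|q [|r P]]] //= _.
- by case=> <-; case: a; [left | right; eexists].
- by case: eqP => // -> [<-]; case: p; [left | right; eexists].
- by case=> <-; case: p q => [] []; [left|left|left|right; eexists].
Qed.

Lemma del_slice_size s st : size (del_slice s st) <= 1.
Proof.
case: s => [i []|i|i b] //=; case: (drop i st) => [|p [|q y]] //=; try by case: p.
by case: ifP.
Qed.

(** According to the marks of the strands involved, deletion leaves the same move or makes both
    sides equal; for instance, an RIII move that loses a strand keeps at most one crossing, the same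
    on both sides. *)
Lemma del_local m l r st st1 : @local_move marked m l r -> run l st = Some st1 ->
  run r st = Some st1 -> tclose (is_crossing_change m) (kept st) (del l st) (del r st).
Proof.
case=> [s s' le|i a|i a|i a b|i b|i a b|i b|i b c d ok|i b].
- rewrite exchangePl // => -[x P Q y y' -> _ sx sP sQ EP Ey] _.
  have sB := del_base sP EP.
  have eP : del_slice s (x ++ P ++ y) = map (raise (kept x)) (del_slice (base s) P).
    by rewrite -(del_slice_frame x y EP) sx raise_base.
  have eP' : del_slice s (x ++ P ++ y') = map (raise (kept x)) (del_slice (base s) P).
    by rewrite -(del_slice_frame x y' EP) sx raise_base.
  have rP := run_slice_frame x y EP; have rP' := run_slice_frame x y' EP.
  rewrite sx raise_base in rP rP'.
  set s2 := raise (position s' - position s) (base s') in Ey.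
  have eo m0 : raise m0 s' = raise (position s + m0) s2 := exchange_offset m0 le.
  have spP : position s + inputs s = size (x ++ P) by rewrite size_cat sx sP.
  have spQ : position s + outputs s = size (x ++ Q) by rewrite size_cat sx sQ.
  have dl z : del_slice (raise (size z) s2) (z ++ y) = map (raise (kept z))
      (del_slice s2 y).
    by have := del_slice_frame z [::] Ey; rewrite !cats0.
  have rP2 : run_slice (raise (size (x ++ P)) s2) (x ++ P ++ y) = Some (x ++ P ++ y').
    by rewrite catA run_slice_pre Ey /= catA.
  rewrite /= !eo spP spQ rP rP2 /= eP eP' !cats0.
  rewrite (catA x P y) (catA x Q y) !dl !kept_cat.
  case: sB => [[-> ->]|[t [-> pt it ot]]]; first by rewrite cats0; exact: tclose_refl.
  have := del_slice_size s2 y; case: (del_slice s2 y) => [|t2 [|//]] _.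
    exact: tclose_refl.
  have oi (s0 : slice unoriented) j : outputs (raise j s0) = outputs s0 /\ inputs
      (raise j s0) = inputs s0.
    by case: s0.
  have pr (s0 : slice unoriented) j : position (raise j s0) = j + position s0
      by case: s0.
  have lex : position (raise (kept x) t) <= position (raise (kept x) t2).
    by rewrite !pr pt addn0 leq_addr.
  have := tclose_exchange (kept x + (inputs t + kept y)) lex.
  rewrite (oi t _).1 (oi t _).2 !raiseD (addnC (outputs t)) (addnC (inputs t) (kept x)).
  by rewrite -(addnA (kept x)) it ot.
all: case: (leqP i (size st)) => [/split_at[x [y [-> <-]]]|lt] /=;
  [ rewrite kept_cat; case: y => [|y1 [|y2 [|y3 y]]] /=; do 5! rewrite ?preE -?catA /=;
    rewrite ?take0 ?drop0 ?kept_cat /= //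
  | have e : (i <= size st) = false by [lia]; have e' : (i < size st) = false by [lia];
    by rewrite ?e ?e' ?(drop_oversize (ltnW lt)) ?(drop_oversize (leqW (ltnW lt))) ].
all: try (move: a); try (move: y1); try (move: y2); try (move: y3).
all: repeat (case=> /=).
all: move=> *; rewrite ?addn0 ?addn1 /=.
all: first [exact: tclose_refl | done | exact: tclose_cup_slide | exact:
    tclose_cap_slide
  | exact: tclose_RI_cup
  | apply: tclose_zigzag_left; lia | apply: tclose_zigzag_right; lia
  | apply: tclose_RII; lia
  | exact: tclose_crossing_change | exact/tclose_leq/tclose_refl
  | exact: tclose_RIII].
Qed.
End Deletion.

Lemma del_elementary m (D E : word marked) : elementary m D E ->
  is_diagram D -> is_diagram E ->
      close (is_crossing_change m) (del D [::]) (del E [::]).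
Proof.
case=> [m' u l r v lr|a w rw].
- rewrite /is_diagram !run_cat; case Eu: (run u [::]) => [st|] //=.
  rewrite !run_cat; case El: (run l st) => [st1|] //=; case Er: (run r st) =>
      [st2|] //=.
  have := run_local lr El; rewrite Er => -[?]; subst st2 => dv _.
  rewrite !(del_cat _ Eu) (del_cat _ El) (del_cat _ Er).
  have [e h] := del_local lr El Er; apply: h.
    by have := del_height Eu.
  apply/is_diagram_height;
      rewrite height_cat (del_height Eu : height _ 0 = _) /= height_cat.
  by rewrite (del_height El) /= (del_height dv).
- move=> dD dE; have hD := del_height dD; have hE := del_height dE; move: hD hE;
    rewrite /=.
  have f1 := run_frame [:: a] [::] rw; rewrite /= in f1.
  have f2 := run_frame [::] [:: a] rw; rewrite /= map_raise0 in f2.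
  rewrite !(del_cat _ f1) !(del_cat _ f2).
  have := del_frame [:: a] [::] rw; have := del_frame [::] [:: a] rw;
      rewrite /= !map_raise0.
  have := del_height rw.
  (* If the closing arc is deleted, both diagrams reduce to [del w]; if it is kept, it still passes
     through infinity. *)
  case: a rw dD dE f1 f2 => /= rw _ _ _ _ h -> -> hD hE.
    by rewrite map_raise0 in hD *; exact/close_refl/is_diagram_height.
  apply: (@step_close _ Isotopy); split;
      [exact/is_diagram_height|exact/is_diagram_height|].
  left; apply: (@through_infinity unoriented tt).
  by have := run_points (del w [:: false]) 1; rewrite h.
Qed.

Lemma diagram_factor (A : labels) (E : word A) (u l v : uword) : is_diagram E ->
    strip E = u ++ l ++ v ->
  exists uE lE vE st st1, [/\ E = uE ++ lE ++ vE,
    [/\ strip uE = u, strip lE = l & strip vE = v],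
    run uE [::] = Some st, run lE st = Some st1 & run vE st1 = Some [::]].
Proof.
move=> dE /strip_cat_inv[uE [w [e1 eu e2]]]; have [lE [vE [e3 el ev]]] :=
    strip_cat_inv e2.
move: dE; rewrite e1 e3 /is_diagram run_cat; case Eu: (run uE _) => [st|] //=.
by rewrite run_cat; case El: (run lE st) => [st1|] //= rv; exists uE, lE, vE, st, st1.
Qed.

Lemma diagram_glue (A : labels) (u l v : word A) st st1 : run u [::] = Some st ->
    run l st = Some st1 ->
  run v st1 = Some [::] -> is_diagram (u ++ l ++ v).
Proof. by move=> ru rl rv; rewrite /is_diagram run_cat ru /= run_cat rl. Qed.

Lemma lift_elementary (A : labels) m (D D' : uword) (E : word A) :
  elementary m D D' -> is_diagram E -> strip E = D ->
  exists E', [/\ strip E' = D', is_diagram E' & elementary m E E'].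
Proof.
case=> [m' u l r v lr|[] w rw] dE.
- case/(diagram_factor dE)=> [uE [lE [vE [st [st1 [-> [<- el <-] ru rl rv]]]]]].
  have [rE [er rr lrE]] := lift_local lr el rl.
  exists (uE ++ rE ++ vE); split; last exact: apply_local.
    by rewrite !strip_cat er.
  exact: diagram_glue ru rr rv.
- case/(@diagram_factor _ _ [:: _] _ [:: _] dE) =>
    [uE [lE [vE [st [st1 [eE [eu el ev] ru rl rv]]]]]].
  case: uE eu eE ru => [|[j a0|j|j b] [|]] //= -[ej] eE; subst j => /= -[est]; subst st.
  case: vE ev eE rv => [|[j a1|j|j b] [|]] //= -[ej] eE rv; subst j.
  have [t et ew] := strip_raise_inv el; subst lE.
  move: rl; have := run_pre t [:: a0] [:: flip a0] => /= ->.
  case rt: (run t _) => [st2|] //= [est1]; subst st1.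
  (* The final cap forces the top label of the tangle to equal its bottom label, as the passage
     through infinity requires. *)
  have e2 : st2 = [:: flip a0].
    by move: rv; case: (st2) => [|b [|c st3]] //=; [case: eqP => // -> | case: eqP].
  subst st2; exists (Cup 0 (flip a0) :: t ++ [:: Cap 0]); split.
  + by rewrite /= strip_cat ew.
  + have := run_frame [::] [:: flip (flip a0)] rt;
      rewrite /= map_raise0 /is_diagram /= run_cat => -> /=.
    by rewrite eqxx.
  + by rewrite eE -{1}[a0]flipK; exact: through_infinity.
Qed.

Lemma lift_elementary_rev (A : labels) m (D D' : uword) (E : word A) :
  elementary m D D' -> is_diagram D -> is_diagram E -> strip E = D' ->
  exists E', [/\ strip E' = D, is_diagram E' & elementary m E' E].
Proof.
case=> [m' u l r v lr|[] w rw] dD dE.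
- case/(diagram_factor dE)=> [uE [rE [vE [st [st1 [-> [eu er ev] ru rr rv]]]]]].
  have hl : height l (size st) <> None.
    move/is_diagram_height: dD;
        rewrite height_cat -eu height_strip (height_run ru : height uE 0 = _) /=.
    by rewrite height_cat; case: (height l (size st)).
  have [lE [el rl lrE]] := lift_local_rev lr er rr hl.
  exists (uE ++ lE ++ vE); split; last exact: apply_local.
    by rewrite !strip_cat el eu ev.
  exact: diagram_glue ru rl rv.
- case/(@diagram_factor _ _ [:: _] _ [:: _] dE) =>
    [uE [lE [vE [st [st1 [eE [eu el ev] ru rl rv]]]]]].
  case: uE eu eE ru => [|[j a0|j|j b] [|]] //= -[ej] eE; subst j => /= -[est]; subst st.
  case: vE ev eE rv => [|[j a1|j|j b] [|]] //= -[ej] eE rv; subst j.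
  (* The closing arc is now on the right. Since the unlabelled tangle runs on a single point, the
     labelled one never touches that arc and also runs alone. *)
  have hw : height lE 1 = Some 1 by rewrite -height_strip el; exact: (height_run rw).
  have [st2 r2 e2] := @run_post _ lE [:: a0] [:: flip a0] _ _ rl hw.
  have e3 : st2 = [:: a0].
    have := height_run r2; rewrite /= hw => -[]; move: rv; rewrite {}e2.
    case: st2 {r2} => [|b [|c st3]] //=; case: eqP => // e _ _.
    by rewrite -[b]flipK -e flipK.
  subst st2 st1; exists (Cup 0 (flip a0) :: map (raise 1) lE ++ [:: Cap 0]); split.
  + by rewrite /= strip_cat strip_map_raise el.
  + have := run_frame [:: flip a0] [::] r2; rewrite /= /is_diagram /= run_cat flipK =>
      -> /=.
    by rewrite flipK eqxx.
  + by rewrite eE; exact: through_infinity.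
Qed.

Lemma del_deforms ms (D D' : uword) (E : word marked) : deforms ms D D' ->
    is_diagram E -> strip E = D ->
  exists E', [/\ strip E' = D', is_diagram E' &
                 close (count is_crossing_change ms) (del E [::]) (del E' [::])].
Proof.
elim: ms D E => [|m ms IH] D E /=.
  case=> _ <- dE eE; exists E; split=> //; apply: close_refl.
  by apply/is_diagram_height; have := del_height dE.
case=> D1 [dD dD1 h] d dE eE.
have [E1 [eE1 dE1 c1]] : exists E1, [/\ strip E1 = D1, is_diagram E1 &
    close (is_crossing_change m) (del E [::]) (del E1 [::])].
  case: h => el.
    have [E1 [? ? ?]] := lift_elementary el dE eE; exists E1; split=> //;
        exact: del_elementary.
  have [E1 [? ? ?]] := lift_elementary_rev el dD1 dE eE.
  by exists E1; split=> //; apply/close_sym/del_elementary.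
have [E' [? ? c2]] := IH _ _ d dE1 eE1; exists E'; split=> //.
exact: close_trans c1 c2.
Qed.

Definition mark_slice (a : marked) (s : slice unoriented) : slice marked :=
  match s with Cup i _ => Cup i a | Cap i => Cap i | Cross i b => Cross i b end.

Fixpoint mark (a : marked) (w : uword) : word marked :=
  if w is s :: w' then
    mark_slice a s :: mark a w'
  else [::].

Lemma strip_mark a w : strip (mark a w) = w.
Proof. by elim: w => [|s w IH] //=; rewrite IH; case: s => // i []. Qed.

Lemma cat_nseq_le (a : marked) i k : i <= k -> nseq i a ++ nseq (k - i) a = nseq k a.
Proof. by move=> le; rewrite cat_nseq /ncons -iterD subnKC. Qed.

Lemma mark_false k k' w : height w k = Some k' ->
  run (mark false w) (nseq k false : seq marked) = Some (nseq k' false) /\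
  del (mark false w) (nseq k false) = w.
Proof.
elim: w k => [|s w IH] k /=; first by case=> ->.
case Es: (slice_height s k) => [k1|] //= /IH[r1 d1].
have kn i : kept (nseq i false) = i by rewrite /kept count_nseq mul1n.
suff [-> ->] : run_slice (mark_slice false s) (nseq k false) = Some (nseq k1 false) /\
    del_slice (mark_slice false s) (nseq k false) = [:: s] by rewrite /= d1.
case: s Es => [i []|i|i b] /=; case: ifP => // lt [<-];
  rewrite ?size_nseq ?lt drop_nseq take_nseq ?kn //; try lia.
- have -> : [:: false, false & nseq (k - i) false] = nseq (k.+2 - i) false.
    by rewrite !subSn ?leqW.
  by rewrite cat_nseq_le ?leqW // ltnW.
- have -> : k - i = (k.-2 - i).+2 by lia.
  by rewrite /= cat_nseq_le //; lia.
- have e : k - i = (k.-2 - i).+2 by lia.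
  rewrite e /= -[[:: _, _ & _]]/(nseq (k.-2 - i).+2 false) -e cat_nseq_le //; lia.
Qed.

Lemma del_circles m (E : word marked) : strip E = circles m -> is_diagram E ->
  exists m', del E [::] = circles m'.
Proof.
elim: m E => [|m IH] E; first by case: E => // _ _; exists 0.
case: E => [|[j a|j|j b] [|[j1 a1|j1|j1 b1] E]] //= [ej ej1 eE]; subst j j1.
rewrite /is_diagram /= eqxx /= => /(IH _ eE)[m' em].
by case: a => /=; rewrite em; [exists m' | exists m'.+1].
Qed.

(** The added circle alone is marked. Deleting it throughout the lifted sequence starts at [D] and
    ends at a union of circles, since deletion only discards some of the final circles. *)
Lemma remove_circle ms m (D : uword) : is_diagram D ->
    deforms ms (circle 0 ++ D) (circles m) ->
  exists m', close (count is_crossing_change ms) D (circles m').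
Proof.
move=> /is_diagram_height/mark_false[rD dD] d.
have [||E' [eE dE c]] :=
    @del_deforms _ _ _ (Cup 0 (true : marked) :: Cap 0 :: mark false D) d.
- by rewrite /is_diagram /=.
- by rewrite /= strip_mark.
have [m' em] := del_circles eE dE; exists m'.
by move: c; rewrite /= dD em.
Qed.

(** * Unknotting numbers *)

Definition unlinks (D : uword) k :=
  exists ms m, deforms ms D (circles m) /\ count is_crossing_change ms = k.

(** The Reidemeister moves at both ends of the sequence are absorbed into it at no cost. *)
Lemma unknotted_unlinks D k : unknotted_by (link_of D) k <-> unlinks D k.
Proof.
split.
  move=> [D0 [ms [E [m [[ms1 r1 d1] d [ms2 r2 d2] ck]]]]].
  exists (ms1 ++ ms ++ rev ms2), m; split.
    exact: deforms_cat d1 (deforms_cat d (deforms_rev d2)).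
  move: r1 r2; rewrite /reidemeister_sequence !has_count -!eqn0Ngt !count_cat count_rev.
  by move=> /eqP-> /eqP->; rewrite addn0.
move=> [ms [m [d ck]]]; exists D, ms, (circles m), m; split=> //.
  by exists [::] => //; split=> //; have [] := deforms_diagram d.
by exists [::] => //; split=> //; have [] := deforms_diagram d.
Qed.

Lemma unlinks_close c D E k : close c D E -> unlinks E k -> exists2 j,
    unlinks D j & j <= c + k.
Proof.
move=> [ms d l] [ms' [m [d' <-]]]; exists (count is_crossing_change (ms ++ ms')).
  by exists (ms ++ ms'), m; split=> //; exact: deforms_cat d d'.
by rewrite count_cat leq_add2r.
Qed.

(** The first case, with the default of [xget], occurs for words that are not diagrams; keeping it
    avoids a proof that crossing changes unlink every diagram. *)
Variant unknotting_number_spec (D : uword) : nat -> Prop :=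
  | UnknottingNone of (forall k, ~ unlinks D k) : unknotting_number_spec D 0
  | UnknottingMin k of unlinks D k & (forall j, unlinks D j -> k <= j) :
      unknotting_number_spec D k.

Lemma unknotting_numberP D :
  unknotting_number_spec D (unknotting_number (link_of D)).
Proof.
have eqv k := unknotted_unlinks D k.
have [[k uk]|none] := pselect (exists k, unlinks D k); last first.
  rewrite /unknotting_number xgetPN; first by constructor=> k uk; apply: none; exists k.
  by move=> k /= [/eqv uk _]; apply: none; exists k.
have ex : exists k, `[< unlinks D k >] by exists k; exact/asboolP.
case: (ex_minnP ex) => n /asboolP un mn.
rewrite /unknotting_number; set P := (X in xget _ X).
have Pn : P n by split; [exact/eqv | move=> j /eqv uj; apply: mn; exact/asboolP].
have [/eqv h1 h2] := xgetPex 0 (ex_intro P n Pn); constructor=> // j /eqv; exact: h2.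
Qed.

Local Open Scope ring_scope.

(** The second hypothesis guards against the default: if [E] has no unlinking sequence, neither has
    [D], and both numbers are 0. *)
Lemma u_le c (D E : uword) :
  (forall k, unlinks E k -> exists2 j, unlinks D j & (j <= c + k)%N) ->
  (forall k, unlinks D k -> exists j, unlinks E j) ->
  u D <= u E + c%:Z.
Proof.
move=> h1 h2; rewrite /u -PoszD lez_nat.
case: (unknotting_numberP E) => [none|k uk mk].
  case: (unknotting_numberP D) => [//|k uk _].
  by have [j /none] := h2 _ uk.
have [j uj le] := h1 _ uk; case: (unknotting_numberP D) =>
    [/(_ j)//|k' _ /(_ _ uj) le'].
by rewrite addnC; exact: leq_trans le' le.
Qed.

Lemma u_close c (D E : uword) : close c D E -> `|u D - u E| <= c%:Z.
Proof.
move=> cl; have cl' := close_sym cl.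
rewrite ler_distl lerBlDr; apply/andP; split.
  apply: u_le => // k uk; first exact: unlinks_close cl' uk.
  by have [j uj _] := unlinks_close cl uk; exists j.
apply: u_le => // k uk; first exact: unlinks_close cl uk.
by have [j uj _] := unlinks_close cl' uk; exists j.
Qed.

Lemma u_close0 (D E : uword) : close 0 D E -> u D = u E.
Proof. by move/u_close; rewrite normr_le0 subr_eq0 => /eqP. Qed.

Lemma u_nondiagram (D : uword) : ~ is_diagram D -> u D = 0.
Proof.
move=> nD; rewrite /u; case: unknotting_numberP => // k [ms [m [d _]]] _.
by have [/nD] := deforms_diagram d.
Qed.

(** Words that are not diagrams are covered by u = 0, so fillings of a hole can be compared without
    checking that they close up. *)
Lemma u_tclose c k l r (p s : uword) : tclose c k l r -> height p 0 = Some k ->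
  `|u (p ++ l ++ s) - u (p ++ r ++ s)| <= c%:Z.
Proof.
move=> lr hp; have [d|nd] := pselect (is_diagram (p ++ l ++ s));
    first exact/u_close/lr.2.
rewrite !u_nondiagram ?subrr ?normr0 // => d; apply: nd.
exact: tclose_diagram (esym lr.1) hp d.
Qed.

Lemma u_add_circle (D : uword) : is_diagram D -> u (circle 0 ++ D) = u D.
Proof.
move=> dD; have dC : is_diagram (circle 0 ++ D)
    by exact/is_diagram_height/is_diagram_height.
have up k : unlinks D k -> exists2 j, unlinks (circle 0 ++ D) j & (j <= 0 + k)%N.
  move=> [ms [m [d <-]]].
  have [|ms' d' le] := @close_add_circle (count is_crossing_change ms) D (circles m).
    by exists ms.
  by exists (count is_crossing_change ms') => //; exists ms', m.+1.
have down k : unlinks (circle 0 ++ D) k -> exists2 j, unlinks D j & (j <= 0 + k)%N.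
  move=> [ms [m [d <-]]]; have [m' [ms' d' le]] := remove_circle dD d.
  by exists (count is_crossing_change ms') => //; exists ms', m'.
apply/le_anti/andP; split; rewrite -[leRHS]addr0; apply: (@u_le 0) => // k.
- by case/down=> j; exists j.
- by case/up=> j; exists j.
Qed.

Lemma u_remove_circle i k (p s : uword) : height p 0 = Some k -> (i <= k)%N ->
  u (p ++ circle i ++ s) = u (p ++ s).
Proof.
move=> hp le; have [d|nd] := pselect (is_diagram (p ++ s)).
  by rewrite (u_close0 (circle_out hp le d)) u_add_circle.
rewrite !u_nondiagram // => /is_diagram_height d; apply: nd; apply/is_diagram_height.
by move: d; rewrite !height_cat hp /= le /= ifT.
Qed.

(** * Variation of iu *)

Section Weights.
Variables (n : nat) (S T : 'M[int]_n).
Hypotheses (hS : S^T = S) (hT : T^T = T).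
Hypothesis hTe : forall i j, T i j \in [:: -1; 0; 1].
Implicit Types (p q : oriented n) (c v h : int) (U : uword -> int).
Implicit Types (s : slice (oriented n)) (w : word (oriented n)) (st : seq (oriented n)).

(** The term of iu at a crossing with over-information b and labels p, q, when
    c, v, h are the unknotting numbers of the link and of its vertical and
    horizontal smoothings. *)
Definition crossing_term c (b : bool) p q v h : int :=
  let par := p.2 == q.2 in
  let sg := if b == par then 1 else -1 in
  if S p.1 q.1 == 1 then T p.1 q.1 * sg * `|(if par then v else h) - c|
  else if S p.1 q.1 == -1 then T p.1 q.1 * sg * `|(if par then h else v) - c|
  else 0.

Definition slice_term c U s st : int :=
  if s is Cross i b then
    if drop i st is p :: q :: _ then
      crossing_term c b p q (U [::]) (U [:: Cap i; UCup i])
    else 0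
  else 0.

(** Sum of the terms of the crossings of a factor w of a diagram; U x is the
    unknotting number of the diagram with x in place of w. *)
Fixpoint factor_iu c U w st : int :=
  if w is s :: w' then
    slice_term c (fun x => U (x ++ strip w')) s st
    + factor_iu c (fun x => U (strip_slice s :: x)) w' (odflt [::] (run_slice s st))
  else 0.

Lemma normT i j : `|T i j| <= 1.
Proof. by have := hTe i j; rewrite !inE => /or3P[] /eqP->. Qed.

Lemma symM (M : 'M[int]_n) i j : M^T = M -> M i j = M j i.
Proof. by move=> e; rewrite -[in LHS]e mxE. Qed.

(** Only one of the two smoothings enters the term, through an absolute value with a coefficient of
    absolute value at most 1. *)
Lemma crossing_term_dist c b p q v h v' h' e : `|v - v'| <= e -> `|h - h'| <= e ->
  `|crossing_term c b p q v h - crossing_term c b p q v' h'| <= e.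
Proof.
move=> hv hh; have e0 : 0 <= e := le_trans (normr_ge0 _) hv.
have aux (t sg x y : int) : `|t| <= 1 -> `|sg| <= 1 -> `|x - y| <= e ->
    `|t * sg * `|x - c| - t * sg * `|y - c| | <= e.
  move=> ht hs hx; rewrite -mulrBr normrM -[leRHS]mul1r.
  apply: ler_pM => //; first by rewrite normrM mulr_ile1.
  apply: le_trans hx; rewrite -[x - y](_ : (x - c) - (y - c) = _);
      first exact: ler_dist_dist.
  by rewrite opprB addrA subrK.
have sg1 (x : bool) : `|if x then 1 else -1 : int| <= 1 by case: x.
rewrite /crossing_term; case: eqP => _; first by apply: aux (normT _ _) (sg1 _) _;
    case: ifP.
case: eqP => _; first by apply: aux (normT _ _) (sg1 _) _; case: ifP.
by rewrite subrr normr0.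
Qed.

(** Compares the two crossings of an RII bigon: the strands have changed places and the same one is
    still over, so the sign is reversed. Symmetry of S and T makes the coefficients agree. *)
Lemma crossing_term_swap c b p q v h :
  crossing_term c (~~ b) q p v h = - crossing_term c b p q v h.
Proof.
rewrite /crossing_term (symM q.1 p.1 hS) (symM q.1 p.1 hT) [q.2 == _]eq_sym.
by case: (S p.1 q.1 == 1); case: (S p.1 q.1 == -1); case: (p.2 == q.2); case: b;
  rewrite /= ?mulrN1 ?mulr1 ?mulNr ?opprK ?oppr0.
Qed.

(** The same crossing seen after a quarter turn, as in the cup and cap slides: reversing one label
    changes parallelism, which compensates both the new over-bit and the exchange of the
    smoothings. *)
Lemma crossing_term_turn c b p q v h :
  crossing_term c (~~ b) q (flip p) h v = crossing_term c b p q v h.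
Proof.
rewrite /crossing_term (symM q.1 _ hS) (symM q.1 _ hT) /=.
by case: (p.2) (q.2) b => [] [] [].
Qed.

Lemma crossing_term0 c b p v h : v = c -> h = c -> crossing_term c b p (flip p) v h = 0.
Proof.
by move=> -> ->; rewrite /crossing_term !if_same subrr normr0 mulr0 !if_same.
Qed.

Lemma factor_iu_cat c U w1 w2 st st1 : run w1 st = Some st1 ->
  factor_iu c U (w1 ++ w2) st =
    factor_iu c (fun x => U (x ++ strip w2)) w1 st
    + factor_iu c (fun x => U (strip w1 ++ x)) w2 st1.
Proof.
elim: w1 U st => [|s w1 IH] U st /=; first by case=> ->; rewrite add0r.
case E: (run_slice s st) => [st2|] //= r1.
rewrite (IH _ _ r1) addrA; congr (_ + _ + _).
by rewrite /slice_term strip_cat; case: s E => // i b _; rewrite !catA.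
Qed.

(** Allows idle strands on the left in one diagram and on the right in the other, as for the closing
    arc before and after its passage through infinity. *)
Lemma factor_iu_congr c U U' (x y : seq (oriented n)) w st st1 : run w st = Some st1 ->
  (forall w' : uword, height w' (size st) = Some (size st1) ->
      U (map (raise (size x)) w') = U' w') ->
  factor_iu c U (map (raise (size x)) w) (x ++ st) = factor_iu c U' w (st ++ y).
Proof.
elim: w U U' st => [|s w IH] U U' st //=.
case E: (run_slice s st) => [st2|] //= r1 HU.
have Ew : height (strip w) (size st2) = Some (size st1)
    by rewrite height_strip (@height_run (oriented n) _ _ _ r1).
have Es := @slice_height_run (oriented n) _ _ _ E.
have := @run_slice_frame (oriented n) _ _ _ x [::] E; rewrite !cats0 => ->.
have := @run_slice_frame (oriented n) _ _ _ [::] y E; rewrite raise0 /= => -> /=.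
have Es' : slice_height (strip_slice s) (size st) = Some (size st2) by rewrite -Es;
    case: (s).
congr (_ + _); last first.
  apply: IH r1 _ => w' hw'; rewrite strip_raise.
  by have := HU (strip_slice s :: w'); apply; rewrite /= Es'.
rewrite strip_map_raise; case/(@run_slice_fits (oriented n)): E HU Es Ew =>
    //= z t b p q HU Es Ew.
rewrite /slice_term -size_cat catA -(catA z) !preE /=.
have sz : size (z ++ [:: q, p & t]) = size (z ++ [:: p, q & t]) by rewrite !size_cat.
rewrite sz in Ew; rewrite HU //; congr crossing_term.
rewrite -[RHS](HU ([:: Cap (size z); UCup (size z)] ++ strip w)) //=.
  by rewrite size_cat.
move: Es; rewrite /=; case: ifP => // lt _.
rewrite /= (_ : (_ <= _)%N); last by move: lt; rewrite !size_cat /=; lia.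
by rewrite /= -Ew; congr (height _ _); move: lt; lia.
Qed.

(** [U] fills a hole in a fixed exterior; the comparison of tangles and the removal of circles are
    all that is assumed about it. *)
Lemma factor_iu_local m l r st st1 k U c : local_move m l r ->
    ~~ is_crossing_change m ->
  run l st = Some st1 -> run r st = Some st1 -> size st = k ->
  (forall d l0 r0, tclose d k l0 r0 -> `|U l0 - U r0| <= d%:Z) ->
  (forall i (w0 : uword), (i <= k)%N -> U (circle i ++ w0) = U w0) ->
  c = U (strip l) ->
  `|factor_iu c U l st - factor_iu c U r st| <= (if is_RII_or_RIII m then 2 else 0).
Proof.
move=> lr cc rl rr ek HU HC ec.
have HU0 l0 r0 : tclose 0 k l0 r0 -> U l0 = U r0.
  by move/HU; rewrite normr_le0 subr_eq0 => /eqP.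
case: lr cc rl rr ec => [s s' le|i a|i a|i a b|i b|i a b|i b|i b c' d ok|//] _.
- move=> rl _ _; have [x P Q y y' est _ sx sP sQ EP Ey] := (exchangePl st st1 le).1 rl.
  have rP := run_slice_frame x y EP; rewrite sx raise_base in rP.
  set s2 := raise (position s' - position s) (base s') in Ey.
  have eo m0 : raise m0 s' = raise (position s + m0) s2 := exchange_offset m0 le.
  have spP : (position s + inputs s)%N = size (x ++ P) by rewrite size_cat sx sP.
  have spQ : (position s + outputs s)%N = size (x ++ Q) by rewrite size_cat sx sQ.
  have rP2 : run_slice (raise (inputs s) s') (x ++ P ++ y) = Some (x ++ P ++ y').
    by rewrite eo spP catA run_slice_pre Ey /= catA.
  have lep : (position (strip_slice s) <= position (strip_slice s'))%N
      by rewrite !strip_slice_position.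
  rewrite /= est rP rP2 /= !addr0.
  (* If [s] is a crossing, its horizontal smoothing is a cap and a cup, and the distant slice is
     exchanged with each of them. The next claim treats [s'] in the same way. *)
  have e1 : slice_term c (fun x0 => U (x0 ++ [:: strip_slice (raise (outputs s) s')]))
      s (x ++ P ++ y)
          = slice_term c (fun x0 =>
              U (strip_slice (raise (inputs s) s') :: x0 ++ [::])) s (x ++ P ++ y').
    case: s le sx sP {sQ rl EP rP s2 Ey eo spP spQ rP2} lep => // i b le sx sP lep.
    rewrite /= in sx lep; subst i.
    case: P sP est => [|p [|q [|//]]] //= _ _; rewrite !preE /=; congr crossing_term.
    move: (size x) lep => i lep.
    rewrite strip_raise; apply: HU0.
    tstep [:: Cap i] [:: UCup i; raise 2 (strip_slice s')]
        [:: raise 0 (strip_slice s'); UCup i] [::].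
      exact: (@tclose_exchange _ (UCup i)).
    rewrite raise0; tstep [::] [:: Cap i; strip_slice s']
        [:: raise 2 (strip_slice s'); Cap i] [:: UCup i].
      by have := @tclose_exchange k (Cap i) (strip_slice s') lep; rewrite /= raise0.
    exact: tclose_refl.
  have e2 : slice_term c (fun x0 => U (strip_slice s :: x0 ++ [::]))
      (raise (outputs s) s') (x ++ Q ++ y)
          = slice_term c (fun x0 => U (x0 ++ [:: strip_slice s]))
              (raise (inputs s) s') (x ++ P ++ y).
    case: s' le lep {Ey rP2 eo s2 rl e1} => // j b le lep; rewrite /slice_term /=.
    have -> : drop (outputs s + j) (x ++ Q ++ y) = drop (j - position s) y.
      by rewrite catA -(drop_prefix (x ++ Q) y (j - position s)) -spQ; congr drop;
          rewrite addnAC subnKC // addnC.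
    have -> : drop (inputs s + j) (x ++ P ++ y) = drop (j - position s) y.
      by rewrite catA -(drop_prefix (x ++ P) y (j - position s)) -spP; congr drop;
          rewrite addnAC subnKC // addnC.
    case: (drop _ y) => [|p [|q z]] //; congr crossing_term; apply: HU0.
    rewrite -(strip_slice_outputs s) -(strip_slice_inputs s).
    move: (strip_slice s) lep => t lep.
    tstep [::] [:: t; raise (outputs t) (Cap j)] [:: raise (inputs t) (Cap j); t]
        [:: UCup (outputs t + j)].
      exact: (@tclose_exchange _ t (Cap j) lep).
    tstep [:: Cap (inputs t + j)] [:: t; raise (outputs t) (UCup j)]
        [:: raise (inputs t) (UCup j); t] [::].
      exact: (@tclose_exchange _ t (UCup j) lep).
    exact: tclose_refl.
  by rewrite e1 e2 [X in X - _]addrC subrr normr0.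
all: case: (leqP i (size st)) => [/split_at[x [y [est <-]]]|lt];
  [ subst st; rewrite size_cat in ek; case: y ek => [|y1 [|y2 [|y3 y]]] ek /=;
    do 5! rewrite ?preE -?catA /=;
    rewrite ?take0 ?drop0 /= //
  | move=> /=; have e : (i <= size st)%N = false by [lia];
      have e' : (i < size st)%N = false by [lia];
    by rewrite ?e ?e' ?(drop_oversize (ltnW lt)) ?(drop_oversize (leqW (ltnW lt))) ].
all: move: (size x) ek => {}i /= ek rl rr ec; rewrite !(add0r, addr0).
(* Cup slide: after the quarter turn, corresponding smoothings differ by cancelling a zigzag. *)
1-3: rewrite -(crossing_term_turn c b) flipK
    (HU0 [:: UCup i; Cap i.+1; UCup i.+1] [:: UCup i.+1]).
1,3,5: rewrite (HU0 [:: UCup i.+1; Cap i; UCup i] [:: UCup i]) ?subrr //.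
1-3: tstep [::] [:: UCup i.+1; Cap i] [::] [:: UCup i]; last exact: tclose_refl.
1-3: by apply: tclose_zigzag_right; lia.
1-3: tstep [::] [:: UCup i; Cap i.+1] [::] [:: UCup i.+1]; last exact: tclose_refl.
1-3: by apply: tclose_zigzag_left; lia.
- move: rl; case: eqP => // -> _.
  have turn := crossing_term_turn c (~~ b) y1 y2; rewrite negbK in turn.
  rewrite turn {turn} (HU0 [:: Cap i.+1; UCup i.+1; Cap i] [:: Cap i.+1]); last first.
    tstep [:: Cap i.+1] [:: UCup i.+1; Cap i] [::] [::]; last exact: tclose_refl.
    by apply: tclose_zigzag_right; lia.
  rewrite (HU0 [:: Cap i; UCup i; Cap i.+1] [:: Cap i]) ?subrr //.
  tstep [:: Cap i] [:: UCup i; Cap i.+1] [::] [::]; last exact: tclose_refl.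
  by apply: tclose_zigzag_left; lia.
(* RI: the vertical smoothing is the uncurled cup, and the horizontal one adds a split circle to
   it. *)
1-4: rewrite crossing_term0 ?normr0 // ec (HU0 _ _ (tclose_RI_cup i b k)) //.
1-4: by have := HC i [:: UCup i]; apply; lia.
(* RII: opposite signs turn the sum into a difference of terms. The vertical smoothings leave one
   crossing each, with opposite over-bits; the horizontal ones both reduce to [[:: Cap i; UCup i]]
   by RI. *)
1-2: rewrite crossing_term_swap; apply: (@le_trans _ _ 1) => //;
    apply: crossing_term_dist.
1,3: by apply: (HU 1); have := @tclose_crossing_change i (~~ b) k; rewrite negbK.
1-2: rewrite (HU0 [:: Cap i; UCup i; Cross i (~~ b)] [:: Cap i; UCup i]); last first.
1,3: apply: (@tclose_ctx [:: Cap i] [::] _ k [:: UCup i; Cross i (~~ b)] [:: UCup i])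
    => ? _.
1,2: exact: tclose_RI_cup.
1-2: rewrite (HU0 [:: Cross i b; Cap i; UCup i] [:: Cap i; UCup i]) ?subrr //.
1-2: apply: (@tclose_ctx [::] [:: UCup i] _ k [:: Cross i b; Cap i] [:: Cap i]) =>
    ? [<-].
1-2: by apply: tclose_RI_cap; lia.
have lt : (i.+2 < k)%N by lia.
(* By the non-cyclicity condition exactly one of c' <> d, b = d, b <> c' holds:
   only the crossing of the top and bottom strands can change its term. *)
have dp p q := @crossing_term_dist c _ p q _ _ _ _ _
    (HU _ _ _ (smooth_first_v i k c' d)) (HU _ _ _ (smooth_first_h lt c' d)).
have dm p q := @crossing_term_dist c _ p q _ _ _ _ _
    (HU _ _ _ (smooth_middle_v lt b d)) (HU _ _ _ (smooth_middle_h i k b d)).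
have dl p q := @crossing_term_dist c _ p q _ _ _ _ _
    (HU _ _ _ (smooth_last_v i k b c')) (HU _ _ _ (smooth_last_h lt b c')).
move: (dp b y1 y2) (dm c' y1 y3) (dl d y2 y3).
do 6! move: (crossing_term _ _ _ _ _ _) => ?.
by case: b c' d ok {ec dp dm dl rl rr} => [] [] [] //= _; lia.
Qed.
End Weights.

(** * From local moves to sequences of moves *)

Lemma strip_local (A : labels) m (l r : word A) : local_move m l r ->
    local_move m (strip l) (strip r).
Proof.
case=> [s s' le|i a|i a|i a b|i b|i a b|i b|i b c d ok|i b] /=.
- rewrite !strip_raise -(strip_slice_inputs s) -(strip_slice_outputs s).
  by apply: exchange; rewrite !strip_slice_position.
- exact: zigzag_left.
- exact: zigzag_right.
- exact: cup_slide.
- exact: cap_slide.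
- exact: (@reidemeister1 unoriented _ tt).
- exact: reidemeister2.
- exact: reidemeister3.
- exact: crossing_change.
Qed.

Lemma u_through_infinity (w : uword) : height w 1 = Some 1%N ->
  u (UCup 0 :: map (raise 1) w ++ [:: Cap 0]) = u (UCup 0 :: w ++ [:: Cap 0]).
Proof.
move=> hw; have rw : run w [:: tt : unoriented] = Some [:: tt : unoriented].
  by have := run_points w 1; rewrite hw.
apply: u_close0; apply: (@step_close _ Isotopy); split; last by left;
    exact: (@through_infinity unoriented tt).
- have := run_frame [:: tt : unoriented] [::] rw; rewrite /= => r1.
  by rewrite /is_diagram /= run_cat r1.
- have := run_frame [::] [:: tt : unoriented] rw; rewrite /= map_raise0 => r1.
  by rewrite /is_diagram /= run_cat r1.
Qed.

Section Invariant.
Variables (n : nat) (S T : 'M[int]_n).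
Implicit Types (D E w : word (oriented n)) (st : seq (oriented n)) (U : uword -> int).

Definition crossing_weight c D (x : crossing n) : int :=
  crossing_term S T c (over_of x) (left_of x) (right_of x)
    (u (vertical_smoothing D x)) (u (horizontal_smoothing D x)).

Lemma iu_sum D : iu S T D = \sum_(x <- crossings D) crossing_weight (u (forget D)) D x.
Proof.
rewrite /iu /regular_crossings /irregular_crossings !big_filter.
rewrite (big_mkcond (fun x => entry S x == 1)) (big_mkcond (fun x => entry S x == -1))
    -big_split /=.
apply: eq_bigr => x _; rewrite /crossing_weight /crossing_term /regular_smoothing
    /irregular_smoothing.
rewrite /entry /crossing_sign /parallel; case: ((left_of x).2 == (right_of x).2);
  case: eqP => [->|_] /=; rewrite ?addr0 ?add0r //.
Qed.

Lemma iu_factor D : is_diagram D -> iu S T D = factor_iu S T (u (forget D)) u D [::].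
Proof.
move=> dD; rewrite iu_sum /crossings.
set c := u (forget D).
(* The prefix [p] already read fixes the index of the next slice and becomes part of the
   exterior. *)
suff gen p w st st1 : D = p ++ w -> run p [::] = Some st -> run w st = Some st1 ->
    \sum_(x <- pmap (crossing_at D) (iota (size p) (size w))) crossing_weight c D x
    = factor_iu S T c (fun x => u (strip p ++ x)) w st.
  exact: (gen [::] D [::] [::]).
elim: w p st => [|s w IH] p st eD rp rw /=; first by rewrite big_nil.
move: rw; rewrite /=; case E: (run_slice s st) => [st2|] //= rw.
have := IH (rcons p s) st2; rewrite size_rcons cat_rcons -cats1 run_cat rp /= E =>
    /(_ eD erefl rw) e.
have on_x (T0 : Type) (x0 y0 : seq T0) i : onth (x0 ++ y0) (size x0 + i) = onth y0 i.
  by rewrite onth_cat ltnNge leq_addr /= addKn.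
have es : onth D (size p) = Some s by rewrite eD -[size p]addn0 on_x.
have lv : level D (size p) = st by rewrite /level eD take_size_cat // rp.
rewrite {IH}[in RHS](_ : factor_iu _ _ _ _ w st2 =
    \sum_(x <- pmap (crossing_at D) (iota (size p).+1 (size w))) crossing_weight c D
    x); last first.
  rewrite e; congr (factor_iu _ _ _ _ _ _); apply/funext => x;
      rewrite strip_cat -catA //.
have -> : crossing_at D (size p) =
    if s is Cross i b then
      if (onth st i, onth st i.+1) is (Some p0, Some q0) then Some
          (Crossing (size p) i b p0 q0)
      else None
    else None by rewrite /crossing_at es /label_at /= lv.
case/(@run_slice_fits (oriented n)): E eD {e rp rw es lv} =>
    [z t a|z t a|z t b p0 q0] eD;
  [by rewrite /= add0r | by rewrite /= add0r | ].
have := on_x _ z [:: p0, q0 & t] 0%N; rewrite addn0 => ->.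
have := on_x _ z [:: p0, q0 & t] 1%N; rewrite addn1 => -> /=.
rewrite big_cons; congr (_ + _); rewrite preE /crossing_weight /=.
rewrite /vertical_smoothing /horizontal_smoothing /replace_slice /=.
have -> : forget D = strip p ++ strip (Cross (size z) b :: w) by rewrite -strip_cat -eD.
have sp : size (strip p) = size p by rewrite size_map.
by rewrite -sp take_size_cat // -addn1 drop_prefix /= drop0.
Qed.

Hypotheses (hS : S^T = S) (hT : T^T = T).
Hypothesis hTe : forall i j, T i j \in [:: -1; 0; 1].

Lemma factor_iu_eq c U U' w st st1 : run w st = Some st1 ->
  (forall w' : uword, height w' (size st) = Some (size st1) -> U w' = U' w') ->
  factor_iu S T c U w st = factor_iu S T c U' w st.
Proof.
move=> rw HU; have := @factor_iu_congr n S T c U U' [::] [::] w st st1 rw.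
by rewrite /= map_raise0 cats0; apply=> w'; rewrite map_raise0; exact: HU.
Qed.

Lemma iu_elementary m D E : elementary m D E -> ~~ is_crossing_change m ->
  is_diagram D -> is_diagram E ->
  `|iu S T D - iu S T E| <= (if is_RII_or_RIII m then 2 else 0).
Proof.
move=> el cc dD dE; rewrite !iu_factor //; case: el cc dD dE =>
    {m D E} [m p l r q lr|a w rw] cc.
- rewrite /is_diagram !run_cat; case rp: (run p [::]) => [st|] //=; rewrite !run_cat.
  case rl: (run l st) => [st1|] //=; case rr: (run r st) => [st2|] //=.
  have := run_local lr rl; rewrite rr => -[?]; subst st2 => rq _.
  have hp : height (strip p) 0 = Some (size st) by rewrite height_strip (height_run rp).
  have hl := height_run rl; have hr := height_run rr.
  have lr0 : tclose 0 (size st) (strip l) (strip r).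
    have := tclose_local (strip_local lr); rewrite (negbTE cc); apply.
    by rewrite !height_strip hl hr.
  have eqU (p0 q0 : uword) : height p0 0 = Some (size st) ->
      u (p0 ++ strip l ++ q0) = u (p0 ++ strip r ++ q0).
    by move/(u_tclose q0 lr0); rewrite normr_le0 subr_eq0 => /eqP.
  have -> : u (forget (p ++ r ++ q)) = u (forget (p ++ l ++ q)).
    by rewrite -![forget _]/(strip _) !strip_cat eqU.
  rewrite !(factor_iu_cat _ _ _ _ _ rp) !(factor_iu_cat _ _ _ _ _ rl)
      !(factor_iu_cat _ _ _ _ _ rr).
  set c := u (forget _).
  (* Smoothing a crossing below or above the factor leaves [l] intact, so the same move still
     applies and the term is unchanged. *)
  have -> : factor_iu S T c (fun x => u (x ++ strip (l ++ q))) p [::]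
          = factor_iu S T c (fun x => u (x ++ strip (r ++ q))) p [::].
    by apply: factor_iu_eq rp _ => w hw; rewrite !strip_cat eqU.
  have -> : factor_iu S T c (fun x => u (strip p ++ strip l ++ x)) q st1
          = factor_iu S T c (fun x => u (strip p ++ strip r ++ x)) q st1.
    by apply: factor_iu_eq rq _ => w hw; rewrite eqU.
  rewrite opprD addrACA subrr add0r opprD addrACA subrr addr0.
  apply: (factor_iu_local hS hT hTe lr cc rl rr erefl).
  + by move=> d l0 r0 t; exact: u_tclose t hp.
  + by move=> i w0 le; rewrite -catA; exact: u_remove_circle hp le.
  + by rewrite /c -[forget _]/(strip _) !strip_cat.
- move=> dD dE; rewrite (_ : `|_| = 0) //; apply/eqP; rewrite normr_eq0 subr_eq0;
    apply/eqP.
  have hw : height (strip w) 1 = Some 1%N by rewrite height_strip (height_run rw).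
  have -> : u (forget (Cup 0 (flip a) :: map (raise 1) w ++ [:: Cap 0])) = u
      (forget (Cup 0 a :: w ++ [:: Cap 0])).
    rewrite -![forget _]/(strip _) /= !strip_cat strip_map_raise;
        exact: u_through_infinity.
  set c := u (forget _).
  have r1 := run_frame [:: flip a] [::] rw; rewrite /= in r1.
  have r2 := run_frame [::] [:: flip a] rw; rewrite /= map_raise0 in r2.
  rewrite /= !add0r (flip_directionK a : flip_direction (flip_direction a) = a).
  rewrite (factor_iu_cat _ _ _ _ _ r1) (factor_iu_cat _ _ _ _ _ r2) /= !addr0.
  apply: (@factor_iu_congr n S T c _ _ [:: flip a] [:: flip a] w [:: a] [:: a] rw) =>
      w' hw'.
  exact: u_through_infinity.
Qed.

Lemma iu_deforms ms D E : reidemeister_sequence ms -> deforms ms D E ->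
  `|iu S T D - iu S T E| <= 2 * (count is_RII_or_RIII ms)%:Z.
Proof.
elim: ms D => [|m ms IH] D /=; first by move=> _ [_ ->]; rewrite subrr normr0.
rewrite /reidemeister_sequence /= negb_or => /andP[cc rs] [D1 [dD dD1 h] d].
have h1 : `|iu S T D - iu S T D1| <= if is_RII_or_RIII m then 2 else 0.
  case: h => el; first exact: iu_elementary el cc dD dD1.
  by rewrite distrC; exact: iu_elementary el cc dD1 dD.
apply: le_trans (ler_distD (iu S T D1) _ _) _.
apply: le_trans (lerD h1 (IH _ rs d)) _.
by rewrite PoszD mulrDr; case: is_RII_or_RIII.
Qed.

End Invariant.

Lemma ceil_half_le (x : int) (k : nat) : x <= 2 * k%:Z ->
    Num.ceil (x%:~R / 2 : rat) <= k%:Z.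
Proof.
move=> le; rewrite ceil_le_int ler_pdivrMr // mulrC.
by rewrite -[2]/(2%:~R) -intrM ler_int.
Qed.

Unset Implicit Arguments.

Theorem corollary1p3 (n : nat) (hn : (1 <= n)%N)
    (L : word (oriented n) -> Prop) (hL : is_oriented_link L)
    (S T : 'M[int]_n)
    (hS : S^T = S) (hT : T^T = T)
    (hSe : forall i j, S i j \in [:: -1; 0; 1])
    (hTe : forall i j, T i j \in [:: -1; 0; 1])
    (hST : forall i j, T i j = 0 <-> S i j = 0)
    (D1 D2 : word (oriented n)) (hD1 : L D1) (hD2 : L D2) :
  (forall ms : seq move, reidemeister_sequence ms -> deforms ms D1 D2 ->
     Num.ceil (`|iu S T D1 - iu S T D2|%:~R / 2 : rat)
       <= (count is_RII_or_RIII ms)%:Z)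
  /\
  (regular_crossings S D2 = [::] -> irregular_crossings S D2 = [::] ->
   forall ms : seq move, reidemeister_sequence ms -> deforms ms D1 D2 ->
     Num.ceil (`|iu S T D1|%:~R / 2 : rat) <= (count is_RII_or_RIII ms)%:Z).
Proof.
split=> [ms r d|r0 i0 ms r d]; apply: ceil_half_le.
  exact: iu_deforms hS hT hTe _ _ _ r d.
have iu0 : iu S T D2 = 0 by rewrite /iu r0 i0 !big_nil.
by have := iu_deforms hS hT hTe r d; rewrite iu0 subr0.
Qed.
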